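(* For $i=1,2$, let $(M_i,\omega_i,\Phi_i)$ be a faithful semitoric system and suppose that $(M_1,\omega_1,\Phi_1)$ contains at least one focus-focus point. Then $(M_1,\omega_1,\Phi_1)$ and $(M_2,\omega_2,\Phi_2)$ are isomorphic as integrable systems if and only if they are isomorphic as complexity one systems.
   Context: Conventions. $S^1=\mathbb{R}/2\pi\mathbb{Z}$. Subsets carry the subspace topology. A map on a subset of $\mathbb{R}^n$ is smooth if locally it extends to a smooth map on an open subset of $\mathbb{R}^n$; a diffeomorphism between subsets is a smooth bijection with smooth inverse. A map $f:X\to Y$ is proper onto its image if $f:X\to f(X)$ is proper (preimages of compact sets are compact). On a symplectic manifold $(M,\omega)$ the Hamiltonian vector field $X_F$ of $F$ is given by $\omega(X_F,\cdot)=dF$, and $\{F,G\}=\omega(X_F,X_G)$. Integrable systems. An integrable system (with two degrees of freedom) is a triple $(M,\omega,\Phi=(J,H))$ with $(M,\omega)$ a 4-dimensional symplectic manifold and $\Phi:M\to\mathbb{R}^2$ smooth with $\{J,H\}=0$ and $\Phi$ a submersion on an open dense subset of $M$. Integrable systems are assumed to have compact fibers, so $\Phi$ generates a Hamiltonian $\mathbb{R}^2$-action (the joint flow of $X_J,X_H$); ''orbit'' means orbit of this action. Almost-toric orbits. A point $p$ is singular if $\operatorname{rk}D_p\Phi<2$; the rank $k$ of an orbit is $\operatorname{rk}D_p\Phi$ at any of its points $p$. For a singular orbit $\mathcal{O}\ni p$, the linearized action of $\mathbb{R}^2$ at $p$ on the symplectic vector space $(T_p\mathcal{O})^{\omega}/T_p\mathcal{O}\cong\mathbb{R}^{2(2-k)}$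 induces a Lie algebra homomorphism $\mathbb{R}^2\to\mathfrak{sp}(2(2-k);\mathbb{R})$ with image $\mathfrak{h}_{\mathcal{O}}$; $\mathcal{O}$ is non-degenerate if $\mathfrak{h}_{\mathcal{O}}$ is a Cartan subalgebra. Identify $\mathfrak{sp}(2m;\mathbb{R})$ with quadratic forms on $\mathbb{R}^{2m}$. A singular orbit is almost-toric if it is compact, non-degenerate and has no hyperbolic block, i.e. in suitable linear symplectic coordinates $\mathfrak{h}_{\mathcal{O}}$ is spanned by: $\frac{x_1^2+y_1^2}{2},\frac{x_2^2+y_2^2}{2}$ (rank 0, elliptic-elliptic); or $x_1y_2-x_2y_1,\ x_1y_1+x_2y_2$ (rank 0, focus-focus point); or $\frac{x^2+y^2}{2}$ (rank 1, elliptic-regular). Faithful semitoric system. An integrable system $(M,\omega,\Phi=(J,H))$ on a connected 4-dimensional symplectic manifold such that: (F1) $\Phi$ is proper onto its image; (F2) all singular orbits of $\Phi$ are almost-toric; (F3) $J$ is the moment map of an effective Hamiltonian $S^1$-action; (F4) every fiber of $J$ is connected; (F5) the set of critical values of $J$ has no limit points in $J(M)$; (F6) every fiber of $J$ contains at most finitely many isolated fixed points of the $S^1$-action. Isomorphisms. $(M_1,\omega_1,\Phi_1)$ and $(M_2,\omega_2,\Phi_2)$ are isomorphic as integrable systems if there is a pair $(\Psi,\psi)$ with $\Psi:(M_1,\omega_1)\to(M_2,\omega_2)$ a symplectomorphism and $\psi:\Phi_1(M_1)\to\Phi_2(M_2)$ a diffeomorphism with $\Phi_2\circ\Psi=\psi\circ\Phi_1$.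 They are isomorphic as complexity one systems if such a pair exists with $\psi=(\psi^{(1)},\psi^{(2)})$ and $\psi^{(1)}(x,y)=\zeta x+a$ for some $\zeta\in\{+1,-1\}$ and $a\in\mathbb{R}$. *)

(* Defs.v *)
From HB Require Import structures.
From mathcomp Require Import all_boot all_order all_algebra.
From mathcomp Require Import all_classical all_reals all_analysis.

Set Implicit Arguments.
Unset Strict Implicit.
Unset Printing Implicit Defensive.

Import Order.TTheory GRing.Theory Num.Theory.
Import numFieldNormedType.Exports.

Local Open Scope classical_set_scope.
Local Open Scope ring_scope.

(* Only meant for U open; the values of f outside U are irrelevant. *)
Fixpoint Ck (R : realType) (V W : normedModType R) (k : nat) (U : set V)
    (f : V -> W) : Prop :=
  match k with
  | 0 => forall x, U x -> {for x, continuous f}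
  | k'.+1 => (forall x, U x -> differentiable f x) /\
             forall v, Ck k' U (fun x => 'D_v f x)
  end.

Definition smooth_open (R : realType) (V W : normedModType R) (U : set V)
  (f : V -> W) : Prop := forall k, Ck k U f.

(* Arbitrary subsets A: f locally extends to a smooth map on an open set. *)
Definition smooth_on (R : realType) (V W : normedModType R) (A : set V)
  (f : V -> W) : Prop :=
  forall x, A x -> exists (U : set V) (g : V -> W),
    [/\ open U, U x, smooth_open U g & forall y, A y -> U y -> g y = f y].

Definition diffeo_on (R : realType) (V W : normedModType R) (A : set V)
  (B : set W) (f : V -> W) : Prop :=
  [/\ smooth_on A f, forall x, A x -> B (f x) &
      exists g : W -> V,
        [/\ smooth_on B g,
            forall y, B y -> A (g y),
            forall x, A x -> g (f x) = x &
            forall y, B y -> f (g y) = y]].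

Record chart (R : realType) (M : topologicalType) (n : nat) := Chart {
  cdom : set M;
  cmap : M -> 'rV[R]_n;
  cinv : 'rV[R]_n -> M;
  cdom_open : open cdom;
  cimg_open : open (cmap @` cdom);
  cmapK : forall p, cdom p -> cinv (cmap p) = p;
  cmap_cont : forall p, cdom p -> {for p, continuous cmap};
  cinv_cont : forall x, (cmap @` cdom) x -> {for x, continuous cinv}
}.

Definition cimg (R : realType) (M : topologicalType) n (c : chart R M n) :
  set 'rV[R]_n := cmap c @` cdom c.

Definition transition (R : realType) (M : topologicalType) n
  (c d : chart R M n) : 'rV[R]_n -> 'rV[R]_n := cmap d \o cinv c.

Record manifold (R : realType) (n : nat) := Manifold {
  mcarrier :> topologicalType;
  atlas : set (chart R mcarrier n);
  manifold_hausdorff : hausdorff_space mcarrier;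
  manifold_second_countable : @second_countable mcarrier;
  atlas_cover : forall p : mcarrier, exists2 c, atlas c & cdom c p;
  atlas_compat : forall c d, atlas c -> atlas d ->
    smooth_open (cmap c @` (cdom c `&` cdom d)) (transition c d)
}.

Definition smooth_fun (R : realType) n (M : manifold R n) (f : M -> R) : Prop :=
  forall c, atlas c -> smooth_open (cimg c) (f \o cinv c).

Definition smooth_map (R : realType) n m (M : manifold R n) (N : manifold R m)
  (f : M -> N) : Prop :=
  continuous f /\
  forall c d, atlas c -> atlas d ->
    smooth_open [set x | cimg c x /\ cdom d (f (cinv c x))]
      (cmap d \o f \o cinv c).

Definition bilin (R : realType) n (W : 'M[R]_n) (u v : 'rV[R]_n) : R :=
  (u *m W *m v^T) 0 0.

(* A 2-form is given by its Gram matrices in the charts of the atlas, subject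
   to the transformation law [sform_compat]; tangent vectors are row vectors
   read in a chart. *)
Record symplectic_form (R : realType) n (M : manifold R n) := SymplecticForm {
  sform : chart R M n -> 'rV[R]_n -> 'M[R]_n;
  sform_smooth : forall c, atlas c -> smooth_open (cimg c) (sform c);
  sform_skew : forall c x, atlas c -> cimg c x ->
    (sform c x)^T = - sform c x;
  sform_nondeg : forall c x, atlas c -> cimg c x -> sform c x \in unitmx;
  sform_closed : forall c x, atlas c -> cimg c x -> forall u v w : 'rV[R]_n,
    'D_u (fun y => bilin (sform c y) v w) x +
    'D_v (fun y => bilin (sform c y) w u) x +
    'D_w (fun y => bilin (sform c y) u v) x = 0;
  sform_compat : forall c d p, atlas c -> atlas d -> cdom c p -> cdom d p ->
    forall u v : 'rV[R]_n,
      bilin (sform c (cmap c p)) u v =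
      bilin (sform d (cmap d p))
        ('d (transition c d) (cmap c p) u) ('d (transition c d) (cmap c p) v)
}.

(* The differential of F in the chart c, as a row of partial derivatives. *)
Definition dchart (R : realType) n (M : manifold R n) (c : chart R M n)
  (F : M -> R) (x : 'rV[R]_n) : 'rV[R]_n :=
  \row_j 'D_(delta_mx 0 j) (F \o cinv c) x.

(* The solution X_F of omega(X_F, .) = dF, see [ham_vfP]. *)
Definition ham_vf (R : realType) n (M : manifold R n) (w : symplectic_form M)
  (c : chart R M n) (F : M -> R) (x : 'rV[R]_n) : 'rV[R]_n :=
  dchart c F x *m invmx (sform w c x).

Lemma ham_vfP (R : realType) n (M : manifold R n) (w : symplectic_form M)
    (c : chart R M n) (F : M -> R) (x X : 'rV[R]_n) :
  atlas c -> cimg c x -> differentiable (F \o cinv c) x ->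
  X = ham_vf w c F x <->
  forall v, bilin (sform w c x) X v = 'd (F \o cinv c) x v.
Proof.
move=> cM cx dF; have Wu := sform_nondeg w cM cx.
have dE (v : 'rV[R]_n) : 'd (F \o cinv c) x v = (dchart c F x *m v^T) 0 0.
  rewrite [in LHS](row_sum_delta v) linear_sum mxE; apply: eq_bigr => j _.
  by rewrite linearZ !mxE deriveE // mulrC.
split=> [-> v|XE]; first by rewrite dE /bilin mulmxKV.
suff XW : X *m sform w c x = dchart c F x by rewrite /ham_vf -XW mulmxK.
apply/rowP => j; have := XE (delta_mx 0 j); rewrite dE /bilin.
by rewrite trmx_delta -!colE !mxE.
Qed.

Definition integral_curve (R : realType) n (M : manifold R n)
  (w : symplectic_form M) (F : M -> R) (g : R -> M) : Prop :=
  continuous g /\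
  forall t c, atlas c -> cdom c (g t) ->
    is_derive t 1 (cmap c \o g) (ham_vf w c F (cmap c (g t))).

(* q is the image of p under the time-t flow of X_F *)
Definition flows_to (R : realType) n (M : manifold R n)
  (w : symplectic_form M) (F : M -> R) (t : R) (p q : M) : Prop :=
  exists g, [/\ integral_curve w F g, g 0 = p & g t = q].

Definition poisson_commute (R : realType) n (M : manifold R n)
  (w : symplectic_form M) (F G : M -> R) : Prop :=
  forall c x, atlas c -> cimg c x ->
    bilin (sform w c x) (ham_vf w c F x) (ham_vf w c G x) = 0.

Definition symplectomorphism (R : realType) n (M N : manifold R n)
  (w : symplectic_form M) (w' : symplectic_form N) (f : M -> N) : Prop :=
  [/\ smooth_map f,
      exists g : N -> M, [/\ smooth_map g, cancel f g & cancel g f] &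
      forall c d p, atlas c -> atlas d -> cdom c p -> cdom d (f p) ->
      forall u v : 'rV[R]_n,
        let D := 'd (cmap d \o f \o cinv c) (cmap c p) in
        bilin (sform w' d (cmap d (f p))) (D u) (D v) =
        bilin (sform w c (cmap c p)) u v].

(* The circle R/2piZ acts through a 2pi-periodic action theta of R; the
   generating vector field of theta is X_F. *)
Definition effective_circle_moment (R : realType) n (M : manifold R n)
  (w : symplectic_form M) (F : M -> R) (theta : R -> M -> M) : Prop :=
  [/\ [/\ forall p, theta 0 p = p,
          forall s t p, theta (s + t) p = theta s (theta t p) &
          forall p, theta (2 * pi) p = p],
      continuous (fun z : R * M => theta z.1 z.2) /\
      (forall c d, atlas c -> atlas d ->
        smooth_open
          [set z : R * 'rV[R]_n |
             cimg c z.2 /\ cdom d (theta z.1 (cinv c z.2))]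
          (fun z => cmap d (theta z.1 (cinv c z.2)))),
      forall p, integral_curve w F (theta^~ p) &
      forall t, (forall p, theta t p = p) ->
        exists k : int, t = k%:~R * (2 * pi)].

(* Gram matrix of sum_i dx_i /\ dy_i, in coordinates (x_1..x_m, y_1..y_m). *)
Definition std_sform (R : realType) m : 'M[R]_(m + m) :=
  block_mx 0 1%:M (- 1%:M) 0.

(* Matrices act on row vectors, from the right. *)
Definition sp (R : realType) m : set 'M[R]_(m + m) :=
  [set A | A *m std_sform R m + std_sform R m *m A^T = 0].

Definition lie (R : realType) n (A B : 'M[R]_n) : 'M[R]_n := A *m B - B *m A.

Definition cartan_subalgebra (R : realType) m (h : set 'M[R]_(m + m)) : Prop :=
  [/\ h `<=` @sp R m,
      [/\ h 0, forall a A B, h A -> h B -> h (a *: A + B) &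
          forall A B, h A -> h B -> h (lie A B)],
      (* h is nilpotent: its lower central series vanishes *)
      exists N, forall (As : seq 'M[R]_(m + m)) B,
        size As = N -> (forall A, A \in As -> h A) -> h B ->
        foldr (@lie R (m + m)) B As = 0 &
      forall A, sp A -> (forall B, h B -> h (lie A B)) -> h A].

(* The quadratic Hamiltonian on R^2m of the linear vector field A in sp:
   q(z) = omega(Az, z) / 2. *)
Definition sp_quad (R : realType) m (A : 'M[R]_(m + m)) (z : 'rV[R]_(m + m)) : R :=
  2^-1 * bilin (std_sform R m) (z *m A) z.

Definition span1 (R : realType) (T : Type) (q : T -> R) : set (T -> R) :=
  [set f | exists a, f = fun z => a * q z].

Definition span2 (R : realType) (T : Type) (q1 q2 : T -> R) : set (T -> R) :=
  [set f | exists a b, f = fun z => a * q1 z + b * q2 z].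

Definition xc (R : realType) m (z : 'rV[R]_(m + m)) (i : 'I_m) : R :=
  z 0 (lshift m i).
Definition yc (R : realType) m (z : 'rV[R]_(m + m)) (i : 'I_m) : R :=
  z 0 (rshift m i).

(* The rank of D_p(J, H), with p the point of coordinates x in the chart c. *)
Definition rank_chart (R : realType) n (M : manifold R n) (J H : M -> R)
  (c : chart R M n) (x : 'rV[R]_n) : nat :=
  \rank (col_mx (dchart c J x) (dchart c H x)).

Definition rank_at (R : realType) n (M : manifold R n) (J H : M -> R)
  (p : M) (k : nat) : Prop :=
  forall c, atlas c -> cdom c p -> rank_chart J H c (cmap c p) = k.

Record integrable_system (R : realType) := IntegrableSystem {
  phase_space : manifold R 4;
  omega : symplectic_form phase_space;
  Jmap : phase_space -> R;
  Hmap : phase_space -> R;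
  J_smooth : smooth_fun Jmap;
  H_smooth : smooth_fun Hmap;
  JH_commute : poisson_commute omega Jmap Hmap;
  submersion_dense : exists U : set phase_space,
    [/\ open U, dense U & forall p, U p -> rank_at Jmap Hmap p 2];
  compact_fibers : forall a b : R,
    compact [set p | Jmap p = a /\ Hmap p = b]
}.

Definition Phi (R : realType) (S : integrable_system R) (p : phase_space S) : R * R :=
  (Jmap p, Hmap p).

Definition singular (R : realType) (S : integrable_system R) (p : phase_space S) :
  Prop :=
  forall c, atlas c -> cdom c p ->
    (rank_chart (@Jmap R S) (@Hmap R S) c (cmap c p) < 2)%N.

Definition flow_orbit (R : realType) (S : integrable_system R) (p : phase_space S) :
  set (phase_space S) :=
  [set q | exists s t m, flows_to (omega S) (@Jmap R S) s p m /\
                         flows_to (omega S) (@Hmap R S) t m q].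

(* The rows span T_pO. *)
Definition orbit_tangent (R : realType) (S : integrable_system R)
  (c : chart R (phase_space S) 4) (p : phase_space S) : 'M[R]_(1 + 1, 4) :=
  col_mx (ham_vf (omega S) c (@Jmap R S) (cmap c p))
         (ham_vf (omega S) c (@Hmap R S) (cmap c p)).

(* Linear symplectic coordinates on (T_pO)^omega / T_pO: the rows of B lie in
   (T_pO)^omega and represent a symplectic basis of the quotient.  They span
   the quotient as soon as m = 2 - rank D_p Phi, since it has dimension 2m. *)
Definition symplectic_frame (R : realType) (S : integrable_system R)
  (c : chart R (phase_space S) 4) (p : phase_space S) m (B : 'M[R]_(m + m, 4)) : Prop :=
  B *m sform (omega S) c (cmap c p) *m (orbit_tangent c p)^T = 0 /\
  B *m sform (omega S) c (cmap c p) *m B^T = std_sform R m.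

(* The algebra h_O in the coordinates B.  An element (a, b) of R^2 acts on T_pM
   when it lies in the isotropy algebra of p, i.e. when X_{aJ+bH} vanishes at
   p; it then acts by the linearization of X_{aJ+bH}.  A is the matrix of the
   operator induced on the quotient. *)
Definition linearized_algebra (R : realType) (S : integrable_system R)
  (c : chart R (phase_space S) 4) (p : phase_space S) m (B : 'M[R]_(m + m, 4)) :
  set 'M[R]_(m + m) :=
  [set A | exists a b : R,
    let X := ham_vf (omega S) c (fun q : phase_space S => a * Jmap q + b * Hmap q) in
    X (cmap c p) = 0 /\
    (B *m jacobian X (cmap c p) - A *m B <= orbit_tangent c p)%MS].

Definition nondegenerate_orbit (R : realType) (S : integrable_system R)
  (p : phase_space S) : Prop :=
  forall k, rank_at (@Jmap R S) (@Hmap R S) p k ->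
  forall c, atlas c -> cdom c p ->
  forall B : 'M[R]_((2 - k) + (2 - k), 4), symplectic_frame c p B ->
    cartan_subalgebra (linearized_algebra c p B).

(* The orbit of p has rank 2 - m, and h_O, seen as a space of quadratic forms,
   is Q in suitable linear symplectic coordinates. *)
Definition has_normal_form (R : realType) (S : integrable_system R)
  (p : phase_space S) m (Q : set ('rV[R]_(m + m) -> R)) : Prop :=
  rank_at (@Jmap R S) (@Hmap R S) p (2 - m) /\
  forall c, atlas c -> cdom c p ->
  exists B : 'M[R]_(m + m, 4), symplectic_frame c p B /\
    @sp_quad R m @` linearized_algebra c p B = Q.

Definition elliptic_elliptic_form (R : realType) : set ('rV[R]_(2 + 2) -> R) :=
  span2 (fun z => (xc z 0 ^+ 2 + yc z 0 ^+ 2) / 2)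
        (fun z => (xc z 1 ^+ 2 + yc z 1 ^+ 2) / 2).

Definition focus_focus_form (R : realType) : set ('rV[R]_(2 + 2) -> R) :=
  span2 (fun z => xc z 0 * yc z 1 - xc z 1 * yc z 0)
        (fun z => xc z 0 * yc z 0 + xc z 1 * yc z 1).

Definition elliptic_regular_form (R : realType) : set ('rV[R]_(1 + 1) -> R) :=
  span1 (fun z => (xc z 0 ^+ 2 + yc z 0 ^+ 2) / 2).

Definition almost_toric (R : realType) (S : integrable_system R)
  (p : phase_space S) : Prop :=
  [/\ compact (flow_orbit p), nondegenerate_orbit p &
      [\/ has_normal_form p (@elliptic_elliptic_form R),
          has_normal_form p (@focus_focus_form R) |
          has_normal_form p (@elliptic_regular_form R)]].

Definition focus_focus (R : realType) (S : integrable_system R)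
  (p : phase_space S) : Prop :=
  [/\ compact (flow_orbit p), nondegenerate_orbit p &
      has_normal_form p (@focus_focus_form R)].

Definition critical_values (R : realType) n (M : manifold R n) (F : M -> R) :
  set R :=
  [set a | exists p, F p = a /\
     forall c, atlas c -> cdom c p -> dchart c F (cmap c p) = 0].

Definition faithful_semitoric (R : realType) (S : integrable_system R) : Prop :=
  let J := @Jmap R S in
  connected [set: phase_space S] /\
  exists theta : R -> phase_space S -> phase_space S,
  [/\ (forall K : set (R * R), K `<=` range (@Phi R S) -> compact K ->
        compact (@Phi R S @^-1` K)),
      (forall p : phase_space S, singular p -> almost_toric p),
      effective_circle_moment (omega S) J theta,
      (forall a, connected (J @^-1` [set a])) &
      (forall a, range J a -> ~ limit_point (critical_values J) a) /\
      (forall a, finite_set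
        (J @^-1` [set a] `&` isolated [set p | forall t, theta t p = p]))].

Definition system_iso (R : realType) (S1 S2 : integrable_system R)
  (Psi : phase_space S1 -> phase_space S2) (psi : R * R -> R * R) : Prop :=
  [/\ symplectomorphism (omega S1) (omega S2) Psi,
      diffeo_on (range (@Phi R S1)) (range (@Phi R S2)) psi &
      forall p, Phi (Psi p) = psi (Phi p)].

Definition integrable_isomorphic (R : realType) (S1 S2 : integrable_system R) :
  Prop := exists Psi psi, @system_iso R S1 S2 Psi psi.

Definition complexity_one_isomorphic (R : realType)
  (S1 S2 : integrable_system R) : Prop :=
  exists Psi psi, @system_iso R S1 S2 Psi psi /\
  exists zeta a : R, (zeta = 1 \/ zeta = -1) /\
    forall z, range (@Phi R S1) z -> (psi z).1 = zeta * z.1 + a.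

(* Main.v *)
(* Put K = J2 o Psi.  It is the moment map of an effective circle action on M1
   and factors through (J, H), so that {J, K} = 0 and the two circle actions
   commute.  Both fix the focus-focus point p.  As X_K is near p a combination
   of X_J and X_H, both linearizations lie in the focus-focus Cartan subalgebra,
   where the elements generating an effective circle action are, up to sign,
   the same one.  Hence, for some sign z, the map theta_K(t) theta_J(-z t) has
   the identity as differential at p; for t = 2 pi / N it has finite order, so
   it is the identity of the connected manifold M1.  Letting N go to infinity,
   X_K = z X_J, and K - z J is constant. *)

Require Import Defs.
From HB Require Import structures.
From mathcomp Require Import all_boot all_order all_algebra.
From mathcomp Require Import all_classical all_reals all_analysis.
From mathcomp Require Import perm ring lra zify.

Set Implicit Arguments.
Unset Strict Implicit.
Unset Printing Implicit Defensive.

Import Order.TTheory GRing.Theory Num.Theory.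
Import numFieldNormedType.Exports.

Local Open Scope classical_set_scope.
Local Open Scope ring_scope.

(** * Differential calculus *)

(** In a focus-focus frame the element with coordinates [a], [b] of the Cartan subalgebra acts on
    the x-plane as multiplication by b + ia and on the y-plane by -b + ia. Periodicity kills [b] and
    makes [a] an integer; effectiveness then gives |a| = 1, since otherwise the flow at time 2 pi /
    |a| (at time pi if a = 0) would be a map of finite order with identity differential at p. At an
    elliptic-elliptic point this would fail: there the algebra contains a whole torus of rotations.
    The times 2 pi / N are singled out because at them both circle actions, and hence their
    commuting composite, have finite order. A derivative at 0 is determined along any sequence
    tending to 0, so these times suffice to compare the generators. The image of Phi need not be
    open, so psi is smooth only through local extensions k, with K = k(J, H) near each point. The
    coefficients of X_K over X_J and X_H are the partial derivatives of k; as X_J and X_H vanish at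
    p, only the values of these coefficients at p enter the linearization. *)

Section differential_calculus.
Variable R : realType.
Implicit Types V W Z : normedModType R.

Lemma near_is_diff V W (f g df : V -> W) x :
  (\near x, f x = g x) -> is_diff x f df -> is_diff x g df.
Proof.
move=> fg [dfx dfE].
have fgx : f x = g x by exact: nbhs_singleton fg.
have gE : g \o shift x = cst (g x) + 'd f x +o_ 0 id.
  apply/eqaddoP => e e0.
  have /eqaddoP/(_ _ e0) := diff_locally dfx.
  have fg0 : \forall h \near 0, f (h + x) = g (h + x).
    by move: fg; rewrite (near_shift 0) subr0.
  by apply: filterS2 fg0 => h /= fgh; rewrite !fctE /= fgh fgx.
have dg : 'd g x = 'd f x :> (V -> W) 
  by apply: diff_unique => //; exact: diff_continuous.
by split; [apply/diff_locallyP; rewrite dg; split=> //; exact: diff_continuous|rewrite dg].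
Qed.

Lemma near_differentiable V W (f g : V -> W) x : differentiable f x ->
  (\near x, f x = g x) -> differentiable g x.
Proof.
by move=> df fg; have [] := near_is_diff fg (differentiableP df).
Qed.

Lemma is_diff_linear V W (f : V -> W) x : linear f -> continuous f ->
  is_diff x f f.
Proof.
move=> fl fc.
pose flM := GRing.isLinear.Build _ _ _ _ _ fl.
pose F : {linear V -> W} := HB.pack f flM.
split; first exact: (@linear_differentiable _ _ _ F).
by rewrite -[f]/(F : V -> W) diff_lin.
Qed.

Lemma scaler_is_bilinear W :
  bilinear_for
    (GRing.Scale.Law.clone _ _ *:%R _) (GRing.Scale.Law.clone _ _ *:%R _)
    (@GRing.scale R W).
Proof.
split=> [u'|u] a x y /=.
- by rewrite scalerDl scalerA.
- by rewrite scalerDr !scalerA mulrC.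
Qed.

Lemma is_diff_scale V W (k dk : V -> R) (f df : V -> W) x :
  is_diff x k dk -> is_diff x f df ->
  is_diff x (fun y => k y *: f y) (fun v => dk v *: f x + k x *: df v).
Proof.
move=> hk hf.
pose bM := bilinear_isBilinear.Build R R W W _ _ (@GRing.scale R W)
  (@scaler_is_bilinear W).
pose b : {bilinear R -> W -> W} := HB.pack (@GRing.scale R W) bM.
have bc : continuous (fun p : R * W => b p.1 p.2) by apply: scale_continuous.
have hb : is_diff (k x, f x) (fun p : R * W => b p.1 p.2)
   (fun q => b (k x) q.2 + b q.1 (f x)).
  by split; [apply: differentiable_bilin|rewrite diff_bilin].
have [d dE] := @is_diff_comp _ _ _ _ _ _ _ _ _ (is_diff_pair hk hf) hb.
split; first exact: d.
by rewrite [LHS]dE; apply/funext => v /=; rewrite addrC.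
Qed.

Lemma is_diff_derive V W (f df : V -> W) x v : is_diff x f df ->
  'D_v f x = df v.
Proof. by move=> [d <-]; rewrite deriveE. Qed.

Lemma is_diff_is_derive V W (f df : V -> W) x v : is_diff x f df ->
  is_derive x v f (df v).
Proof.
move=> h; split; last exact: is_diff_derive.
by apply: diff_derivable; case: h.
Qed.

End differential_calculus.

(** * Smooth functions on open subsets of normed spaces *)

Section smooth_calculus.
Variable R : realType.
Implicit Types V W Z : normedModType R.

Lemma open_near (T : topologicalType) (U : set T) (x : T) :
  open U -> U x -> \near x, U x.
Proof. by move=> Uo Ux; apply: open_nbhs_nbhs. Qed.

Lemma near_continuous (S T : topologicalType) (f g : S -> T) (x : S) :
  (\near x, f x = g x) -> {for x, continuous f} -> {for x, continuous g}.
Proof.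
move=> fg fc; have fgx : f x = g x by exact: nbhs_singleton fg.
move: fc; rewrite /prop_for /continuous_at fgx; apply: cvg_trans.
by apply: near_eq_cvg; apply: filterS fg => y ->.
Qed.

(** Openness turns agreement on [U] into agreement near each of its points, which is what
    derivatives see. *)
Lemma eq_Ck V W k (U : set V) (f g : V -> W) : open U ->
  (forall x, U x -> f x = g x) -> Ck k U f -> Ck k U g.
Proof.
move=> Uo; elim: k f g => [|k IH] f g fg.
  move=> fc x Ux; apply: near_continuous (fc x Ux).
  by apply: filterS (open_near Uo Ux).
move=> [df dk]; split=> [x Ux|v].
  by apply: near_differentiable (df x Ux) _; apply: filterS (open_near Uo Ux).
apply: IH (dk v) => x Ux; apply: near_eq_derive.
by apply: filterS (open_near Uo Ux).
Qed.

Lemma sub_Ck V W k (U U' : set V) (f : V -> W) : U' `<=` U ->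
  Ck k U f -> Ck k U' f.
Proof.
move=> UU; elim: k f => [f h x /UU|k IH f [df dk]]; first exact: h.
by split=> [x /UU|v]; [exact: df|exact: IH (dk v)].
Qed.

Lemma CkW V W k (U : set V) (f : V -> W) : Ck k.+1 U f -> Ck k U f.
Proof.
elim: k f => [f [df _] x Ux|k IH f [df dk]].
  exact/differentiable_continuous/df.
by split=> // v; exact: IH (dk v).
Qed.

Lemma Ck_cst V W k (U : set V) (a : W) : Ck k U (fun=> a).
Proof.
elim: k a => [a x _|k IH a]; first exact: cst_continuous.
split=> [x _|v]; first exact: differentiable_cst.
suff -> : 'D_v (fun=> a : W) = (fun=> 0) :> (V -> W) by [].
by apply/funext => x; rewrite derive_cst.
Qed.

Lemma CkD V W k (U : set V) (f g : V -> W) : open U -> Ck k U f -> Ck k U g ->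
  Ck k U (fun x => f x + g x).
Proof.
move=> Uo; elim: k f g => [f g fc gc x Ux|k IH f g [df dk] [dg dl]].
  exact: (@continuousD _ _ _ f g x (fc x Ux) (gc x Ux)).
split=> [x Ux|v]; first exact: (differentiableD (df x Ux) (dg x Ux)).
apply: eq_Ck (IH _ _ (dk v) (dl v)) => // x Ux.
by rewrite -[RHS]/('D_v (f + g) x) deriveD //;
  apply/diff_derivable; [exact: df|exact: dg].
Qed.

Lemma Ck_sum V W k (U : set V) (I : Type) (r : seq I) (f : I -> V -> W) :
  open U -> (forall i, Ck k U (f i)) -> Ck k U (fun x => \sum_(i <- r) f i x).
Proof.
move=> Uo fC; elim: r => [|i r IH].
  by apply: eq_Ck (@Ck_cst V W k U 0) => // x; rewrite big_nil.
by apply: eq_Ck (CkD Uo (fC i) IH) => // x _; rewrite big_cons.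
Qed.

Lemma CkZ V W k (U : set V) (a : V -> R) (f : V -> W) : open U -> Ck k U a ->
  Ck k U f -> Ck k U (fun x => a x *: f x).
Proof.
move=> Uo; elim: k a f => [a f ac fc x Ux|k IH a f [da dk] [df dl]].
  exact: (@continuousZ _ _ _ a f x (ac x Ux) (fc x Ux)).
have dZ x (Ux : U x) :=
  is_diff_scale (differentiableP (da x Ux)) (differentiableP (df x Ux)).
split=> [x Ux|v]; first by have [] := dZ x Ux.
have fk : Ck k U f by apply: CkW.
have ak : Ck k U a by apply: CkW.
apply: eq_Ck (CkD Uo (IH _ _ (dk v) fk) (IH _ _ ak (dl v))) => // x Ux.
rewrite (is_diff_derive v (dZ x Ux)) !deriveE //; [exact: df|exact: da].
Qed.

Lemma CkM V k (U : set V) (a b : V -> R) : open U -> Ck k U a ->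
  Ck k U b -> Ck k U (fun x => a x * b x).
Proof. by move=> Uo ha hb; apply: (CkZ Uo ha hb). Qed.

Lemma Ck_linear V W k (U : set V) (l : V -> W) : linear l -> continuous l ->
  Ck k U l.
Proof.
move=> ll lc; case: k => [|k] //=; first by move=> x _; apply: lc.
split=> [x _|v]; first by have [] := is_diff_linear x ll lc.
suff -> : 'D_v l = (fun=> l v) by exact: Ck_cst.
by apply/funext => x; apply: (is_diff_derive v (is_diff_linear x ll lc)).
Qed.

Lemma Ck_linear_comp V W Z k (U : set V) (f : V -> W) (l : W -> Z) : open U ->
  linear l -> continuous l -> Ck k U f -> Ck k U (l \o f).
Proof.
move=> Uo ll lc; elim: k f => [f fc x Ux|k IH f [df dk]].
  by apply: continuous_comp; [exact: fc|exact: lc].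
have d x (Ux : U x) :=
  is_diff_comp (differentiableP (df x Ux)) (is_diff_linear (f x) ll lc).
split=> [x Ux|v]; first by have [] := d x Ux.
apply: eq_Ck (IH _ (dk v)) => // x Ux.
by rewrite (is_diff_derive v (d x Ux)) /= deriveE //; exact: df.
Qed.

(* The finite-dimensional normed modules, described by a basis with continuous
   coordinate forms so as to cover both row vectors and products. *)
Definition finite_basis W := exists n (e : 'I_n -> W) (l : 'I_n -> W -> R),
  (forall i, linear (l i : W -> R^o) /\ continuous (l i)) /\
  forall w, w = \sum_i l i w *: e i.

Lemma finite_basis_rV n : finite_basis 'rV[R]_n.
Proof.
exists n, (delta_mx 0), (fun i (w : 'rV[R]_n) => w 0 i); split=> [i|w]; last first.
  exact: row_sum_delta.
by split=> [a u v|]; [rewrite !mxE|exact: coord_continuous].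
Qed.

Lemma finite_basis_R : finite_basis R.
Proof.
exists 1%N, (fun=> 1), (fun _ w => w); split=> [i|w].
  by split=> // x; exact: cvg_id.
by rewrite big_ord1 /GRing.scale /= mulr1.
Qed.

Lemma finite_basis_prod W Z : finite_basis W -> finite_basis Z ->
  finite_basis (W * Z)%type.
Proof.
move=> [n [e [l [lP lE]]]] [m [f [k [kP kE]]]].
exists (n + m)%N, (fun i : 'I_(n + m) => match fintype.split i with inl j => (e j, 0)
   | inr j => (0, f j) end), (fun (i : 'I_(n + m)) w => match fintype.split i with inl j => l j w.1
   | inr j => k j w.2 end); split=> [i|w].
  case: (fintype.split i) => j; [have [ll lc] := lP j|have [ll lc] := kP j];
    split; try by move=> a u v /=; rewrite ll.
  - move=> w; apply: (@continuous_comp _ _ _ fst (l j)); last exact: lc.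
    exact: cvg_fst.
  - move=> w; apply: (@continuous_comp _ _ _ snd (k j)); last exact: lc.
    exact: cvg_snd.
rewrite big_split_ord /=.
under eq_bigr do rewrite (unsplitK (inl _)).
under [X in _ + X]eq_bigr do rewrite (unsplitK (inr _)).
rewrite [LHS]surjective_pairing [in LHS](lE w.1) [in LHS](kE w.2).
have fstS p (F : 'I_p -> W * Z) : (\sum_i F i).1 = \sum_i (F i).1.
  exact: (big_morph (fun z : W * Z => z.1) (fun _ _ => erefl) erefl).
have sndS p (F : 'I_p -> W * Z) : (\sum_i F i).2 = \sum_i (F i).2.
  exact: (big_morph (fun z : W * Z => z.2) (fun _ _ => erefl) erefl).
apply/pair_equal_spec; split.
  by rewrite !fstS [X in _ + X]big1 ?addr0 // => i _; rewrite /= scaler0.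
by rewrite !sndS [X in X + _]big1 ?add0r // => i _; rewrite /= scaler0.
Qed.

(** [Ck] only controls derivatives in fixed directions, while the chain rule differentiates [g] in
    the moving direction ['D_v f x]. Expanding that direction in a basis gives a sum of products of
    [Ck] functions, to which the induction hypothesis applies. *)
Lemma Ck_comp V W Z k (U : set V) (O : set W) (f : V -> W) (g : W -> Z) :
  finite_basis W -> open U -> (forall x, U x -> O (f x)) ->
  Ck k U f -> Ck k O g -> Ck k U (g \o f).
Proof.
move=> [n [e [l [lP lE]]]] Uo fUO; elim: k g => [g fc gc x Ux|k IH g hf hg].
  by apply: continuous_comp; [exact: fc|exact/gc/fUO].
have [df dk] := hf; have [dg dl] := hg.
have d x (Ux : U x) := is_diff_comp (differentiableP (df x Ux))
  (differentiableP (dg _ (fUO x Ux))).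
split=> [x Ux|v]; first by have [] := d x Ux.
have hS j : Ck k U (fun x => l j ('D_v f x) *: ((fun y => 'D_(e j) g y) \o f) x).
  apply: CkZ => //.
    by have [lj lc] := lP j; apply: (Ck_linear_comp Uo lj lc (dk v)).
  by apply: IH (CkW hf) (dl (e j)).
apply: eq_Ck (Ck_sum (index_enum _) Uo hS) => // x Ux.
rewrite (is_diff_derive v (d x Ux)) /=.
rewrite [in RHS](lE ('d f x v)) linear_sum; apply: eq_bigr => i _.
by rewrite linearZ /= !deriveE //; [exact: dg (fUO x Ux)|exact: df].
Qed.

End smooth_calculus.

(** * Mean value theorem and symmetry of second derivatives *)

Section mean_value.
Variable R : realType.
Implicit Types V W Z : normedModType R.

Lemma Ck_pair V W Z k (U : set V) (f : V -> W) (g : V -> Z) : open U ->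
  Ck k U f -> Ck k U g -> Ck k U (fun x => (f x, g x)).
Proof.
move=> Uo; elim: k f g => [f g fc gc x Ux|k IH f g [df dk] [dg dl]].
  exact: (cvg_pair (fc x Ux) (gc x Ux)).
split=> [x Ux|v]; first by apply: differentiable_pair; [exact: df|exact: dg].
apply: eq_Ck (IH _ _ (dk v) (dl v)) => // x Ux.
rewrite (is_diff_derive v (is_diff_pair (differentiableP (df x Ux))
  (differentiableP (dg x Ux)))) !deriveE //; [exact: dg|exact: df].
Qed.

Lemma is_derive_line V W (f : V -> W) (x w : V) (s : R) :
  differentiable f (x + s *: w) ->
  is_derive s 1 (fun t => f (x + t *: w)) ('D_w f (x + s *: w)).
Proof.
move=> df.
have dl : is_diff s (fun t : R => x + t *: w) (fun t : R => 0 + t *: w).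
  by apply: is_diffD.
have := @is_diff_is_derive R R W _ _ _ 1 (is_diff_comp dl (differentiableP df)).
by rewrite /= add0r scale1r deriveE.
Qed.

Lemma line_MVT V (f : V -> R) (x w : V) (h : R) : 0 <= h ->
  (forall s, 0 <= s <= h -> differentiable f (x + s *: w)) ->
  exists2 c, 0 <= c <= h & f (x + h *: w) - f x = h * 'D_w f (x + c *: w).
Proof.
move=> h0 df.
pose g t := f (x + t *: w); pose dg t := 'D_w f (x + t *: w).
have gd s : s \in `[0, h] -> is_derive s 1 g (dg s).
  by rewrite in_itv /= => sh; apply: is_derive_line; apply: df.
have gc : {within `[0, h], continuous g}.
  by apply: derivable_within_continuous => s sh; have [] := gd s sh.
have gd' s : s \in `]0, h[%R -> is_derive s 1 g (dg s).
  by move=> sh; apply: gd; move: sh; rewrite !in_itv /= => /andP[/ltW-> /ltW->].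
have [c ch E] := MVT_segment h0 gd' gc.
exists c; first by move: ch; rewrite in_itv.
by rewrite -/(g h) -/(dg c) mulrC -[h in RHS]subr0 -E /g scale0r addr0.
Qed.

(** Two applications of the mean value theorem write the quotient as ['D_v ('D_u f)] at a point of
    the parallelogram spanned by h u and h v; continuity of this derivative at [x] concludes. *)
Lemma second_difference V (U : set V) (f : V -> R) (x u v : V) (e : R) :
  open U -> U x -> Ck 2 U f -> 0 < e ->
  \forall h \near 0^'+,
    `|(f (x + h *: u + h *: v) - f (x + h *: u) - f (x + h *: v) + f x)
      / h ^+ 2 - 'D_v ('D_u f) x| <= e.
Proof.
move=> Uo Ux [df d2] e0; have [du dvu] := d2 u.
have /nbhs_ballP[r /= r0 rP] : \forall z \near x, U z /\
    `|'D_v ('D_u f) x - 'D_v ('D_u f) z| <= e.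
  apply: filterI; first exact: open_near.
  by have /cvgrPdist_le/(_ _ e0) := dvu v x Ux.
(* For [h] below this bound the parallelogram stays in the ball of radius [r]; the 1 covers the case
   u = v = 0. *)
have r1 : 0 < r / (`|u| + `|v| + 1) by rewrite divr_gt0 // ltr_wpDl // addr_ge0.
near=> h.
have h0 : 0 < h by near: h; exact: nbhs_right_gt.
have hr : h < r / (`|u| + `|v| + 1) by near: h; exact: nbhs_right_lt.
have {rP} P c d : 0 <= c <= h -> 0 <= d <= h ->
    U (x + c *: u + d *: v) /\
    `|'D_v ('D_u f) x - 'D_v ('D_u f) (x + c *: u + d *: v)| <= e.
  move=> /andP[c0 ch] /andP[d0 dh]; apply: rP.
  rewrite -ball_normE /= -addrA opprD addrA subrr add0r normrN.
  apply: le_lt_trans (ler_normD _ _) _; rewrite !normrZ !ger0_norm //.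
  rewrite ltr_pdivlMr in hr; last by rewrite ltr_wpDl // addr_ge0.
  apply: le_lt_trans hr; rewrite !mulrDr mulr1 -[leLHS]addr0.
  by rewrite !lerD ?ler_wpM2r // ltW.
pose phi y := f (y + h *: v) - f y.
have hh : 0 <= h <= h by rewrite lexx ltW.
have zh : 0 <= (0 : R) <= h by rewrite lexx ltW.
have dphi s : 0 <= s <= h -> is_diff (x + s *: u) phi
    (fun w => 'd f (x + s *: u + h *: v) w - 'd f (x + s *: u) w).
  move=> sh.
  have dS : is_diff (x + s *: u) (fun y => y + h *: v) (fun y => y + 0).
    exact: is_diffD.
  have dfS : differentiable f (x + s *: u + h *: v).
    by apply: df; have [] := P _ _ sh hh.
  have dfs : differentiable f (x + s *: u).
    by apply: df; have [+ _] := P _ _ sh zh; rewrite scale0r addr0.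
  have [d dE] := is_diffB (is_diff_comp dS (differentiableP dfS))
    (differentiableP dfs).
  split=> //; rewrite [LHS]dE; apply/funext => y /=.
  by rewrite !fctE /= addr0.
have [|c ch] := @line_MVT V phi x u h (ltW h0); first by move=> s /dphi[].
rewrite (is_diff_derive u (dphi c ch)) /= /phi => E1.
have [|d dh] := @line_MVT V ('D_u f) (x + c *: u) v h (ltW h0).
  by move=> s sh; apply: du; have [] := P _ _ ch sh.
rewrite !(@deriveE _ _ _ f) => [E2||]; first last.
- by apply: df; have [] := P _ _ ch hh.
- by apply: df; have [+ _] := P _ _ ch zh; rewrite scale0r addr0.
have -> : f (x + h *: u + h *: v) - f (x + h *: u) - f (x + h *: v) + f x =
  h ^+ 2 * 'D_v ('D_u f) (x + c *: u + d *: v).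
  by rewrite expr2 -mulrA -E2 -E1; ring.
rewrite mulrC mulKf ?expf_neq0 ?gt_eqF // distrC.
by have [] := P c d ch dh.
Unshelve. all: by end_near. Qed.

(** The second difference is symmetric in [u] and [v], so one and the same number is within e / 2 of
    both mixed derivatives. *)
Lemma Schwarz_real V (U : set V) (f : V -> R) (x u v : V) :
  open U -> U x -> Ck 2 U f -> 'D_u ('D_v f) x = 'D_v ('D_u f) x.
Proof.
move=> Uo Ux f2; apply/eqP; rewrite -subr_eq0 -normr_le0; apply/ler_addgt0Pl.
move=> e e0; rewrite addr0.
have e2 : 0 < e / 2 by rewrite divr_gt0.
have Hu := second_difference u v Uo Ux f2 e2.
have Hv := second_difference v u Uo Ux f2 e2.
have [h [/= {}Hu {}Hv]] := filter_ex (filterI Hu Hv).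
rewrite [e]splitr; apply: le_trans (lerD Hv Hu).
have tri (a b c : R) : `|a - b| <= `|c - a| + `|c - b|.
  by rewrite [`|c - a|]distrC -[a - b](subrKA c) ler_normD.
set c := (X in `|X - _| + _); set d := (X in _ + `|X - _|).
have -> : d = c by rewrite /c /d [x + h *: v + h *: u]addrAC; congr (_ / _); ring.
by clearbody c; apply: tri.
Qed.

Lemma derive_entry V m n (f : V -> 'M[R]_(m, n)) x v i j :
  derivable f x v -> ('D_v f x) i j = 'D_v (fun y => f y i j) x.
Proof. by move=> fd; rewrite derive_mx // mxE. Qed.

Lemma Schwarz V m n (U : set V) (f : V -> 'M[R]_(m, n)) (x u v : V) :
  open U -> U x -> Ck 2 U f -> 'D_u ('D_v f) x = 'D_v ('D_u f) x.
Proof.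
move=> Uo Ux f2; have [df d2] := f2; have [du1 _] := d2 u.
have [dv1 _] := d2 v; apply/matrixP => i j.
have fij : Ck 2 U (fun x => f x i j).
  apply: (@Ck_linear_comp _ _ _ _ _ _ f (fun M => M i j)) => //.
    by move=> a M N; rewrite !mxE.
  exact: coord_continuous.
have E w : \forall y \near x, 'D_w f y i j = 'D_w (fun x => f x i j) y.
  apply: filterS (open_near Uo Ux) => y Uy.
  by apply: derive_entry; apply: diff_derivable; exact: df.
have du := @diff_derivable _ _ _ _ _ u (dv1 x Ux).
have dv := @diff_derivable _ _ _ _ _ v (du1 x Ux).
apply: etrans (derive_entry i j du) _; apply: esym.
apply: etrans (derive_entry i j dv) _.
apply: etrans (near_eq_derive _ (E u)) _; apply: esym.
apply: etrans (near_eq_derive _ (E v)) _.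
exact: Schwarz_real fij.
Qed.

End mean_value.

(** * Maps close to the identity *)

Section strict_differentiability.
Variable R : realType.

Lemma mx_entry_le_norm m n (M : 'M[R]_(m, n)) i j : `|M i j| <= `|M|.
Proof.
rewrite [leRHS]/Num.Def.normr /= mx_normrE.
exact: (le_bigmax _ (fun ij : 'I_m * 'I_n => `|M ij.1 ij.2|) (i, j)).
Qed.

Lemma mx_norm_le m n (M : 'M[R]_(m, n)) e : 0 <= e ->
  (forall i j, `|M i j| <= e) -> `|M| <= e.
Proof.
move=> e0 h; rewrite [leLHS]/Num.Def.normr /= mx_normrE.
by apply: bigmax_le => // -[i j] _; exact: h.
Qed.

(** Mean value theorem for each coordinate along the segment from [y] to [x], which stays in the
    ball by convexity. *)
Lemma strict_near_id n (T : 'rV[R]_n -> 'rV[R]_n) (U : set 'rV[R]_n)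
    (x0 : 'rV[R]_n) (e : R) : open U -> U x0 -> Ck 1 U T ->
  (forall v, 'D_v T x0 = v) -> 0 < e ->
  exists2 r, 0 < r & forall x y, ball x0 r x -> ball x0 r y ->
    `|T x - T y - (x - y)| <= e * `|x - y|.
Proof.
move=> Uo Ux0 [dT cT] T1 e0.
(* The [n] partial derivatives contribute at most n e / (n + 1) <= e; the successor avoids a
   division by 0 when n = 0. *)
have e1 : 0 < e / n.+1%:R by rewrite divr_gt0.
have nU := open_near Uo Ux0.
have nD : \forall z \near x0, forall j : 'I_n,
    `|'D_(delta_mx 0 j) T z - delta_mx 0 j| <= e / n.+1%:R.
  apply: (@filter_forall _ _ (fun j z =>
    `|'D_(delta_mx 0 j) T z - delta_mx 0 j| <= e / n.+1%:R) (nbhs x0)) => j.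
  have /cvgrPdist_le/(_ _ e1) := cT (delta_mx 0 j) x0 Ux0.
  by apply: filterS => z; rewrite T1 distrC.
have /nbhs_ballP[r /= r0 rP] : \forall z \near x0, U z /\
    forall j : 'I_n, `|'D_(delta_mx 0 j) T z - delta_mx 0 j| <= e / n.+1%:R.
  exact: filterI nU nD.
exists r => // x y xr yr.
have seg s : 0 <= s <= 1 -> ball x0 r (y + s *: (x - y)).
  move=> /andP[s0 s1]; move: xr yr; rewrite -!ball_normE /= => xr yr.
  have -> : x0 - (y + s *: (x - y)) = s *: (x0 - x) + (1 - s) *: (x0 - y).
    by apply/rowP => i; rewrite !mxE; ring.
  apply: le_lt_trans (ler_normD _ _) _; rewrite !normrZ !ger0_norm ?subr_ge0 //.
  have [->|s0'] := eqVneq s 0; first by rewrite mul0r subr0 mul1r add0r.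
  have -> : r = s * r + (1 - s) * r by ring.
  apply: ltr_leD; first by rewrite ltr_pM2l // lt_neqAle eq_sym s0'.
  by rewrite ler_wpM2l ?subr_ge0 // ltW.
apply: mx_norm_le => [|i j]; first by rewrite mulr_ge0 // ltW.
rewrite {i}ord1 !mxE.
have dj z : U z -> is_diff z (fun z => T z 0 j) (fun v => ('d T z v) 0 j).
  move=> Uz; have dc : is_diff (T z) (fun M : 'rV[R]_n => M 0 j) (fun M => M 0 j).
    apply: is_diff_linear; last exact: coord_continuous.
    by move=> a M N; rewrite !mxE.
  exact: (is_diff_comp (differentiableP (dT _ Uz)) dc).
have [|c c01] := @line_MVT _ _ (fun z => T z 0 j) y (x - y) 1 ler01.
  by move=> s /seg/rP[/dj[]].
have [Uc Dc] := rP _ (seg c c01).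
rewrite scale1r subrKC (is_diff_derive _ (dj _ Uc)) mul1r => ->.
set z := y + _ in Uc Dc *.
have rowE (v : 'rV[R]_n) : v 0 j = \sum_k v 0 k * (delta_mx 0 k : 'rV[R]_n) 0 j.
  rewrite {1}(row_sum_delta v) summxE; apply: eq_bigr => k _.
  by rewrite [LHS]mxE.
have DE (v : 'rV[R]_n) :
    ('d T z v) 0 j = \sum_k v 0 k * ('D_(delta_mx 0 k) T z) 0 j.
  rewrite {1}(row_sum_delta v) linear_sum summxE; apply: eq_bigr => k _.
  by rewrite linearZ [LHS]mxE deriveE //; exact: dT.
have -> : x 0 j - y 0 j = (x - y) 0 j by rewrite !mxE.
rewrite (rowE (x - y)) (DE (x - y)).
rewrite -sumrB; apply: le_trans (ler_norm_sum _ _ _) _.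
apply: (@le_trans _ _ (\sum_(k < n) `|x - y| * (e / n.+1%:R))).
  apply: ler_sum => k _; rewrite -mulrBr normrM ler_pM //.
    exact: mx_entry_le_norm.
  apply: le_trans (Dc k).
  by rewrite (le_trans _ (mx_entry_le_norm _ 0 j)) // !mxE.
rewrite sumr_const card_ord -mulrnAr mulrC ler_wpM2r //.
rewrite -[e / _ *+ n]mulr_natr -mulrA ler_piMr ?(ltW e0) //.
by rewrite mulrC ler_pdivrMr ?ltr0n // mul1r ler_nat.
Qed.

(** The increments [u k] sum to 0 over a period, hence N u_0 is minus the sum of the deviations u_k
    - u_0. With e = 2^-N each deviation has norm at most (1 - e) |u_0|, which forces u_0 = 0. *)
Lemma finite_order_fixed (V : normedModType R) (T : V -> V) (x0 x : V) (r : R)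
    N : (0 < N)%N ->
  (forall y z, ball x0 r y -> ball x0 r z ->
     `|T y - T z - (y - z)| <= (2 ^+ N)^-1 * `|y - z|) ->
  (forall k, (k <= N)%N -> ball x0 r (iter k T x)) -> iter N T x = x ->
  T x = x.
Proof.
move=> N0 hT xr xN; set e := _^-1 in hT.
pose u k := iter k.+1 T x - iter k T x.
have e0 : 0 <= e by rewrite invr_ge0 exprn_ge0.
have e1 : e <= 1 by rewrite invf_le1 ?exprn_gt0 // exprn_ege1 // ler1n.
(* Since u_(k+1) - u_k has norm at most e |u_k|, a bound c |u_0| on the deviation becomes (e (1 + c)
   + c) |u_0|, at most (e + 2 c) |u_0| as e <= 1. The solution of this recursion is (2^k - 1) e. *)
have uk k : (k < N)%N -> `|u k - u 0| <= (2 ^+ k - 1) * e * `|u 0|.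
  elim: k => [|k IH] kN; first by rewrite !subrr normr0 !mul0r.
  have {}IH := IH (ltnW kN).
  have -> : u k.+1 - u 0 = (u k.+1 - u k) + (u k - u 0) by rewrite addrA subrK.
  apply: le_trans (ler_normD _ _) _.
  have h1 : `|u k.+1 - u k| <= e * `|u k|.
    apply: (hT (iter k.+1 T x) (iter k T x)); first exact: xr (ltnW _).
    by apply: xr; do 2 apply: ltnW.
  have h2 : `|u k| <= `|u 0| + (2 ^+ k - 1) * e * `|u 0|.
    by rewrite -[u k](subrKC (u 0)); apply: le_trans (ler_normD _ _) _; rewrite lerD2l.
  apply: le_trans (lerD (le_trans h1 (ler_wpM2l e0 h2)) IH) _.
  have a0 : 0 <= 2 ^+ k - 1 :> R by rewrite subr_ge0 exprn_ege1 // ler1n.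
  have b0 : (2 ^+ k - 1) * e * `|u 0| * e <= (2 ^+ k - 1) * e * `|u 0|.
    by rewrite ler_piMr // !mulr_ge0.
  rewrite exprS; nra.
have su : \sum_(k < N) u k = 0.
  by rewrite -(big_mkord xpredT u) telescope_sumr // xN /= subrr.
have : N%:R * `|u 0| <= N%:R * ((1 - e) * `|u 0|).
  rewrite -{1}[N%:R]ger0_norm // -normrZ scaler_nat.
  have -> : u 0 *+ N = - \sum_(k < N) (u k - u 0).
    by rewrite sumrB su sub0r opprK sumr_const card_ord.
  rewrite normrN; apply: le_trans (ler_norm_sum _ _ _) _.
  rewrite mulr_natl -[X in _ *+ X]card_ord -sumr_const; apply: ler_sum => k _.
  apply: le_trans (uk k (ltn_ord k)) _; rewrite ler_wpM2r //.
  have <- : (2 ^+ N - 1) * e = 1 - e.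
    by rewrite mulrBl mul1r mulfV // expf_neq0 // pnatr_eq0.
  by rewrite ler_wpM2r // lerB // ler_eXn2l ?ltr1n // ltnW.
rewrite ler_pM2l ?ltr0n // mulrBl mul1r lerBrDr gerDl => h.
apply/eqP; rewrite -subr_eq0 -normr_le0 -(@pmulr_rle0 _ e) //.
by rewrite invr_gt0 exprn_gt0.
Qed.

End strict_differentiability.

(** * Calculus in charts *)

Section charts.
Variable R : realType.

Lemma cmap_cimg (M : topologicalType) n (c : chart R M n) p :
  cdom c p -> cimg c (cmap c p).
Proof. by move=> cp; exists p. Qed.

Lemma cinv_cdom (M : topologicalType) n (c : chart R M n) x :
  cimg c x -> cdom c (cinv c x).
Proof. by move=> [p cp <-]; rewrite cmapK. Qed.

Lemma cinvK (M : topologicalType) n (c : chart R M n) x :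
  cimg c x -> cmap c (cinv c x) = x.
Proof. by move=> [p cp <-]; rewrite cmapK. Qed.

Lemma near_cdom (M : topologicalType) n (c : chart R M n) p :
  cdom c p -> \forall q \near p, cdom c q.
Proof. by move=> cp; apply: open_near => //; exact: cdom_open. Qed.

Lemma near_cimg (M : topologicalType) n (c : chart R M n) x :
  cimg c x -> \forall y \near x, cimg c y.
Proof. by move=> cx; apply: open_near => //; exact: cimg_open. Qed.

Lemma cinv_cvg (M : topologicalType) n (c : chart R M n) p : cdom c p ->
  cinv c y @[y --> cmap c p] --> p.
Proof.
move=> cp; have := @cinv_cont _ _ _ c (cmap c p) (cmap_cimg cp).
by rewrite /prop_for /continuous_at cmapK.
Qed.

Lemma near_chart (M : topologicalType) n (c : chart R M n) p (P : set M) :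
  cdom c p -> (\forall q \near p, P q) ->
  \forall y \near cmap c p, P (cinv c y).
Proof. by move=> cp /(cinv_cvg cp). Qed.

Definition loc n m (M : manifold R n) (N : manifold R m) (f : M -> N)
  (c : chart R M n) (d : chart R N m) : 'rV[R]_n -> 'rV[R]_m :=
  cmap d \o f \o cinv c.

Lemma continuous_chart_dom n m (M : manifold R n) (N : manifold R m)
    (f : M -> N) (c : chart R M n) (d : chart R N m) : continuous f ->
  open [set x | cimg c x /\ cdom d (f (cinv c x))].
Proof.
move=> fc; rewrite openE => x [cx dx].
have h : \forall y \near cmap c (cinv c x), cdom d (f (cinv c y)).
  apply: (near_chart (P := fun q => cdom d (f q))); first exact: cinv_cdom.
  exact: (fc _ _ (near_cdom dx)).
rewrite (cinvK cx) in h.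
by apply: filterI h; exact: near_cimg.
Qed.

(* To be used with h a function on N, or a chart composed with a map from N. *)
Lemma is_diff_chart_comp n m (M : manifold R n) (N : manifold R m)
    (W : normedModType R) (f : M -> N) (h : N -> W)
    (c : chart R M n) (d : chart R N m) (p : M) :
  {for p, continuous f} -> cdom c p -> cdom d (f p) ->
  differentiable (loc f c d) (cmap c p) ->
  differentiable (h \o cinv d) (cmap d (f p)) ->
  is_diff (cmap c p) (h \o f \o cinv c)
    ('d (h \o cinv d) (cmap d (f p)) \o 'd (loc f c d) (cmap c p)).
Proof.
move=> fc cp dfp df dh.
have lp : loc f c d (cmap c p) = cmap d (f p) by rewrite /loc /= cmapK.
have dh' : differentiable (h \o cinv d) (loc f c d (cmap c p)) by rewrite lp.
have := is_diff_comp (differentiableP df) (differentiableP dh').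
rewrite lp; apply: near_is_diff.
have hd : \forall q \near p, (h \o cinv d) ((cmap d \o f) q) = h (f q).
  have hq : \forall q \near p, cdom d (f q) by exact: fc (near_cdom dfp).
  by apply: filterS hq => q dq /=; rewrite cmapK.
exact: (near_chart cp hd).
Qed.

Lemma is_derive_chart n (M : manifold R n) (W : normedModType R)
    (g : R -> M) (h : M -> W) (c : chart R M n) (t : R) (v : 'rV[R]_n) :
  {for t, continuous g} -> cdom c (g t) ->
  is_derive t 1 (cmap c \o g) v ->
  differentiable (h \o cinv c) (cmap c (g t)) ->
  is_derive t 1 (h \o g) ('d (h \o cinv c) (cmap c (g t)) v).
Proof.
move=> gc cg dg dh.
have := dg; move=> [/derivable1_diffP ddg gv].
have := @is_diff_is_derive R R W _ _ _ 1 (is_diff_comp (differentiableP ddg)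
  (differentiableP dh)).
rewrite /= -[X in is_derive _ _ _ ('d _ _ X)]deriveE // gv.
have gs : \forall s \near t, cdom c (g s) by exact: gc (near_cdom cg).
apply: near_eq_is_derive; apply: filterS gs => s cs /=.
by rewrite cmapK.
Qed.

Lemma dchartE n (M : manifold R n) (c : chart R M n) (F : M -> R) x v :
  differentiable (F \o cinv c) x ->
  'd (F \o cinv c) x v = (dchart c F x *m v^T) 0 0.
Proof.
move=> dF; rewrite [in LHS](row_sum_delta v) linear_sum mxE.
apply: eq_bigr => j _.
by rewrite linearZ !mxE deriveE // mulrC.
Qed.

Lemma bilin_delta n (W : 'M[R]_n) i j :
  bilin W (delta_mx 0 i) (delta_mx 0 j) = W i j.
Proof. by rewrite /bilin trmx_delta -colE -rowE !mxE. Qed.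

(** If [A] is the matrix of the differential, invariance of the form reads A W' A^T = W. This makes
    [A] invertible, and X_F is carried over by inverting this identity. *)
Lemma ham_vf_natural n (M N : manifold R n) (w : symplectic_form M)
    (w' : symplectic_form N) (f : M -> N) (F : N -> R)
    (c : chart R M n) (d : chart R N n) (p : M) :
  atlas c -> atlas d -> cdom c p -> cdom d (f p) ->
  {for p, continuous f} -> differentiable (loc f c d) (cmap c p) ->
  (forall u v, bilin (sform w' d (cmap d (f p)))
     ('d (loc f c d) (cmap c p) u) ('d (loc f c d) (cmap c p) v) =
     bilin (sform w c (cmap c p)) u v) ->
  differentiable (F \o cinv d) (cmap d (f p)) ->
  'd (loc f c d) (cmap c p) (ham_vf w c (F \o f) (cmap c p)) =
  ham_vf w' d F (cmap d (f p)).
Proof.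
move=> ac ad cp dp fc df symp dF.
have [dFf dFfE] := is_diff_chart_comp fc cp dp df dF.
set x := cmap c p in df symp dFf dFfE *; set y := cmap d (f p) in symp dF dFfE *.
pose A := lin1_mx ('d (loc f c d) x).
have AE v : 'd (loc f c d) x v = v *m A by rewrite mul_rV_lin1.
have Wu : sform w c x \in unitmx by apply: sform_nondeg => //; exact: cmap_cimg.
have Wu' : sform w' d y \in unitmx by apply: sform_nondeg => //; exact: cmap_cimg.
have AWA : A *m sform w' d y *m A^T = sform w c x.
  apply/matrixP => i j; rewrite -!bilin_delta -symp /bilin !AE.
  by rewrite trmx_mul !mulmxA.
have Au : A \in unitmx.
  by move: Wu; rewrite -AWA !unitmx_mul => /andP[/andP[]].
have dc : dchart c (F \o f) x = dchart d F y *m A^T.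
  apply/rowP => j; pose e : 'rV[R]_n := delta_mx 0 j.
  have E : (dchart c (F \o f) x *m e^T) 0 0 = (dchart d F y *m (e *m A)^T) 0 0.
    rewrite -(AE e); apply: etrans (esym (dchartE e dFf)) _.
    by apply: etrans (congr1 (fun h => h e) dFfE) _; exact: dchartE.
  by move: E; rewrite trmx_mul mulmxA trmx_delta -!colE ![col _ _ _ _]mxE.
(* The left-hand side is a right inverse of W', as one sees after multiplying by [A] on the left and
   cancelling it. *)
have MA : A^T *m invmx (A *m sform w' d y *m A^T) *m A = invmx (sform w' d y).
  set X := _ *m A.
  have WX : sform w' d y *m X = 1%:M.
    have AX : A *m (sform w' d y *m X) = A.
      by rewrite /X !mulmxA mulmxV ?AWA // mul1mx.
    by rewrite -[LHS](mulKmx Au) AX mulVmx.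
  by rewrite -[LHS](mulKmx Wu') WX mulmx1.
by rewrite AE /ham_vf dc -AWA -MA !mulmxA.
Qed.

End charts.

(** * Smooth maps and symplectomorphisms of manifolds *)

Section smooth_maps.
Variable R : realType.

Lemma Ck_local (V W : normedModType R) k (U : set V) (f : V -> W) :
  (forall x, U x -> exists2 U' : set V, open U' /\ U' x & Ck k U' f) -> Ck k U f.
Proof.
elim: k f => [|k IH] f h.
  by move=> x Ux; have [U' [_ U'x]] := h x Ux; apply.
split=> [x Ux|v].
  by have [U' [_ U'x] [+ _]] := h x Ux; apply.
apply: IH => x Ux; have [U' U'x [_ hD]] := h x Ux.
by exists U'; [|exact: hD].

Qed.

Lemma smooth_map_loc n m (M : manifold R n) (N : manifold R m) (f : M -> N)
    c d p : smooth_map f -> atlas c -> atlas d -> cdom c p -> cdom d (f p) ->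
  exists2 U : set 'rV[R]_n, open U /\ U (cmap c p) & smooth_open U (loc f c d).
Proof.
move=> [fc fs] ac ad cp dp.
exists [set x | cimg c x /\ cdom d (f (cinv c x))]; last exact: fs.
split; first exact: continuous_chart_dom.
by split; [exact: cmap_cimg|rewrite cmapK].
Qed.

Lemma smooth_map_diff n m (M : manifold R n) (N : manifold R m) (f : M -> N)
    c d p : smooth_map f -> atlas c -> atlas d -> cdom c p -> cdom d (f p) ->
  differentiable (loc f c d) (cmap c p).
Proof.
move=> fs ac ad cp dp; have [U [_ Ux] sU] := smooth_map_loc fs ac ad cp dp.
by have [+ _] := sU 1%N; apply.
Qed.

Lemma smooth_fun_diff n (M : manifold R n) (F : M -> R) c p : smooth_fun F ->
  atlas c -> cdom c p -> differentiable (F \o cinv c) (cmap c p).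
Proof.
move=> sF ac cp; have [+ _] := sF c ac 1%N; apply; exact: cmap_cimg.
Qed.

(** The local form of the identity is the transition map, so a change of charts becomes a case of
    the chain rule for smooth maps. *)
Lemma smooth_map_id n (M : manifold R n) : smooth_map (@id M).
Proof.
split=> [|c d ac ad]; first by move=> x; exact: cvg_id.
have -> : [set x | cimg c x /\ cdom d (cinv c x)] =
    cmap c @` (cdom c `&` cdom d).
  apply/seteqP; split=> [x [cx dx]|_ [p [cp dp] <-]].
    by exists (cinv c x); [split=> //; exact: cinv_cdom|exact: cinvK].
  by split; [exact: cmap_cimg|rewrite cmapK].
exact: (atlas_compat ac ad).
Qed.

(** Smoothness is local, so the intermediate chart [d] may change from point to point. The sets
    [O d], on which [h] read in [d] is smooth, let the lemma serve both functions and maps on N. *)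
Lemma smooth_comp_chart n m (M : manifold R n) (N : manifold R m)
    (W : normedModType R) (f : M -> N) (h : N -> W) (U : set 'rV[R]_n)
    (O : chart R N m -> set 'rV[R]_m) c :
  smooth_map f -> atlas c -> open U -> U `<=` cimg c ->
  (forall d, atlas d -> open (O d)) ->
  (forall x d, atlas d -> U x -> cdom d (f (cinv c x)) ->
     O d (cmap d (f (cinv c x)))) ->
  (forall d, atlas d -> smooth_open (O d) (h \o cinv d)) ->
  smooth_open U (h \o f \o cinv c).
Proof.
move=> fs ac Uo Uc Oo UO hs k; apply: Ck_local => x Ux.
have [d ad dx] := atlas_cover (f (cinv c x)).
pose U' := U `&` [set x | cimg c x /\ cdom d (f (cinv c x))].
have U'o : open U'.
  by apply: openI => //; apply: continuous_chart_dom; case: fs.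
exists U'; first by split=> //; split=> //; split=> //; exact: Uc.
have fU' : Ck k U' (loc f c d).
  by apply: (@sub_Ck _ _ _ _ [set x | cimg c x /\ cdom d (f (cinv c x))]);
    [move=> y []|case: fs => _ fs; exact: fs].
have := Ck_comp (finite_basis_rV R m) U'o _ fU' (hs d ad k).
have U'O y : U' y -> O d (loc f c d y) by move=> [Uy [cy dy]]; exact: UO.
move=> /(_ U'O); apply: eq_Ck => // y [_ [cy dy]] /=.
by rewrite cmapK.
Qed.

Lemma smooth_fun_comp n m (M : manifold R n) (N : manifold R m)
    (f : M -> N) (F : N -> R) :
  smooth_map f -> smooth_fun F -> smooth_fun (F \o f).
Proof.
move=> fs Fs c ac.
apply: (@smooth_comp_chart _ _ _ _ _ _ _ _ (fun d => cimg d)) => //.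
- exact: cimg_open.
- by move=> d _; exact: cimg_open.
- by move=> x d ad cx dx; exact: cmap_cimg.
Qed.

Lemma smooth_map_comp n m l (M : manifold R n) (N : manifold R m)
    (P : manifold R l) (f : M -> N) (g : N -> P) :
  smooth_map f -> smooth_map g -> smooth_map (g \o f).
Proof.
move=> fs gs; have [fc _] := fs; have [gc gs'] := gs.
have gfc : continuous (g \o f).
  by move=> x; apply: continuous_comp; [exact: fc|exact: gc].
split=> // c e ac ae.
apply: (@smooth_comp_chart _ _ _ _ _ _ (cmap e \o g) _
  (fun d => [set x | cimg d x /\ cdom e (g (cinv d x))])) => //.
- exact: continuous_chart_dom.
- by move=> x [].
- by move=> d _; exact: continuous_chart_dom.
- move=> x d ad [cx ex] dx /=; split; first exact: cmap_cimg.
  by rewrite cmapK.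
- by move=> d ad; exact: gs'.
Qed.

Lemma diff_loc_comp n m l (M : manifold R n) (N : manifold R m)
    (P : manifold R l) (f : M -> N) (g : N -> P) c d e p :
  smooth_map f -> smooth_map g -> atlas c -> atlas d -> atlas e ->
  cdom c p -> cdom d (f p) -> cdom e (g (f p)) -> forall v,
  'd (loc (g \o f) c e) (cmap c p) v =
  'd (loc g d e) (cmap d (f p)) ('d (loc f c d) (cmap c p) v).
Proof.
move=> fs gs ac ad ae cp dp ep v; have [fc _] := fs.
have df := smooth_map_diff fs ac ad cp dp.
have dg := smooth_map_diff gs ad ae dp ep.
have [_ E] := is_diff_chart_comp (h := cmap e \o g) (fc p) cp dp df dg.
exact: (congr1 (fun h => h v) E).
Qed.

Lemma diff_loc_id n (M : manifold R n) (c : chart R M n) p v :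
  cdom c p -> 'd (loc id c c) (cmap c p) v = v.
Proof.
move=> cp.
have E : \forall x \near cmap c p, id x = loc id c c x.
  by apply: filterS (near_cimg (cmap_cimg cp)) => x cx; rewrite /loc /= cinvK.
by have [_ ->] := near_is_diff E (is_diff_id _).
Qed.

Lemma symplectomorphism_inv n (M N : manifold R n) (w : symplectic_form M)
    (w' : symplectic_form N) (f : M -> N) (g : N -> M) :
  symplectomorphism w w' f -> smooth_map g -> cancel f g -> cancel g f ->
  symplectomorphism w' w g.
Proof.
move=> [fs _ fw] gs fK gK; split=> //; first by exists f.
move=> d c q ad ac dq cq u v /=.
have dfq : cdom d (f (g q)) by rewrite gK.
have := fw c d (g q) ac ad cq dfq.
rewrite /= gK => <-.
have E z : 'd (loc f c d) (cmap c (g q)) ('d (loc g d c) (cmap d q) z) = z.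
  rewrite -(diff_loc_comp gs fs ad ac ad dq cq dfq).
  have -> : f \o g = id by apply/funext => x; exact: gK.
  exact: diff_loc_id.
by congr bilin; exact: E.
Qed.

Lemma symplectomorphism_ham_vf n (M N : manifold R n) (w : symplectic_form M)
    (w' : symplectic_form N) (f : M -> N) (F : N -> R) c d p :
  symplectomorphism w w' f -> smooth_fun F -> atlas c -> atlas d ->
  cdom c p -> cdom d (f p) ->
  'd (loc f c d) (cmap c p) (ham_vf w c (F \o f) (cmap c p)) =
  ham_vf w' d F (cmap d (f p)).
Proof.
move=> [fs _ fw] sF ac ad cp dp.
have [fc _] := fs.
apply: (ham_vf_natural ac ad cp dp (fc p)).
- exact: smooth_map_diff.
- by move=> u v; exact: fw.
- exact: smooth_fun_diff.
Qed.

End smooth_maps.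

(** * Transport of a circle action along a symplectomorphism *)

Section transport.
Variable R : realType.

Lemma linear_fst (V W : normedModType R) : linear (fst : V * W -> V).
Proof. by []. Qed.

Lemma linear_snd (V W : normedModType R) : linear (snd : V * W -> W).
Proof. by []. Qed.

Lemma continuous_fst (V W : topologicalType) : continuous (fst : V * W -> V).
Proof. by move=> z; exact: cvg_fst. Qed.

Lemma continuous_snd (V W : topologicalType) : continuous (snd : V * W -> W).
Proof. by move=> z; exact: cvg_snd. Qed.

Definition prod_chart_dom n m (M : manifold R n) (N : manifold R m)
    (phi : R -> M -> N) (c : chart R M n) (d : chart R N m) :
    set (R * 'rV[R]_n) :=
  [set z | cimg c z.2 /\ cdom d (phi z.1 (cinv c z.2))].

Lemma prod_chart_cvg n (M : manifold R n) (c : chart R M n)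
    (z : R * 'rV[R]_n) : cimg c z.2 ->
  ((y.1, cinv c y.2) : R * M) @[y --> z] --> (z.1, cinv c z.2).
Proof.
move=> cz.
have h1 : (y : R * 'rV[R]_n).1 @[y --> z] --> z.1 by exact: continuous_fst.
have h2 : cinv c (y : R * 'rV[R]_n).2 @[y --> z] --> cinv c z.2.
  apply: continuous_comp; first exact: continuous_snd.
  exact: (@cinv_cont _ _ _ c z.2 cz).
exact: cvg_pair h1 h2.
Qed.

Lemma near_prod_chart n (M : manifold R n) (c : chart R M n)
    (z : R * 'rV[R]_n) (P : set (R * M)) : cimg c z.2 ->
  nbhs (z.1, cinv c z.2) P -> \forall y \near z, P (y.1, cinv c y.2).
Proof. by move=> cz; apply: prod_chart_cvg. Qed.

Lemma near_snd_cimg n (M : manifold R n) (c : chart R M n)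
    (z : R * 'rV[R]_n) : cimg c z.2 -> \forall y \near z, cimg c y.2.
Proof. by move=> cz; exact: (@continuous_snd _ _ z _ (near_cimg cz)). Qed.

Lemma open_prod_chart_dom n m (M : manifold R n) (N : manifold R m)
    (phi : R -> M -> N) c d : continuous (fun z : R * M => phi z.1 z.2) ->
  open (prod_chart_dom phi c d).
Proof.
move=> fc; rewrite openE => z [cz dz].
have h : nbhs (z.1, cinv c z.2) [set y : R * M | cdom d (phi y.1 y.2)].
  exact: (fc (z.1, cinv c z.2) _ (near_cdom dz)).
exact: filterI (near_snd_cimg cz) (near_prod_chart cz h).
Qed.

Definition smooth_flow n (M : manifold R n) (th : R -> M -> M) :=
  continuous (fun z : R * M => th z.1 z.2) /\
  forall c d, atlas c -> atlas d -> smooth_open (prod_chart_dom th c d)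
    (fun z : R * 'rV[R]_n => cmap d (th z.1 (cinv c z.2))).

Lemma smooth_flow_transport n (M N : manifold R n) (f : M -> N) (g : N -> M)
    (th : R -> N -> N) : smooth_map f -> smooth_map g -> smooth_flow th ->
  smooth_flow (fun t p => g (th t (f p))).
Proof.
move=> fs gs [thc ths]; have [fc fs'] := fs; have [gc gs'] := gs.
have c1 : continuous (fun z : R * M => f z.2).
  move=> z; apply: (@continuous_comp _ _ _ snd f); last exact: fc.
  exact: continuous_snd.
have c2 : continuous (fun z : R * M => th z.1 (f z.2)).
  move=> z; apply: (@continuous_comp _ _ _ (fun z : R * M => (z.1, f z.2))
    (fun z : R * N => th z.1 z.2)); last exact: thc.
  exact: cvg_pair (@continuous_fst _ _ z) (c1 z).
have c3 : continuous (fun z : R * M => g (th z.1 (f z.2))).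
  by move=> z; apply: (@continuous_comp _ _ _ _ g); [exact: c2|exact: gc].
split=> // c e ac ae k; apply: Ck_local => z [cz ez].
have [d ad dz] := atlas_cover (f (cinv c z.2)).
have [d' ad' d'z] := atlas_cover (th z.1 (f (cinv c z.2))).
(* On this neighbourhood the three successive images lie in [d], [d'] and [e], so the composite can
   be read in fixed charts. *)
pose U := prod_chart_dom (fun _ p => f p) c d `&`
  prod_chart_dom (fun t p => th t (f p)) c d' `&`
  prod_chart_dom (fun t p => g (th t (f p))) c e.
have Uo : open U.
  apply: openI; first apply: openI.
  - exact: (open_prod_chart_dom (phi := fun _ p => f p)).
  - exact: (open_prod_chart_dom (phi := fun t p => th t (f p))).
  - exact: (open_prod_chart_dom (phi := fun t p => g (th t (f p)))).
exists U; first by [].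
have h1 : Ck k U (fun y : R * 'rV[R]_n => (y.1, loc f c d y.2)).
  apply: Ck_pair => //; first exact: Ck_linear (@linear_fst R _) (@continuous_fst R _).
  apply: (Ck_comp (finite_basis_rV R n) Uo _
    (Ck_linear _ _ (@linear_snd R _) (@continuous_snd R _)) (fs' c d ac ad k)).
  by move=> y [[[]]].
have h2 : Ck k U ((fun y : R * 'rV[R]_n => cmap d' (th y.1 (cinv d y.2))) \o
    (fun y => (y.1, loc f c d y.2))).
  apply: (Ck_comp _ Uo _ h1 (ths d d' ad ad' k)).
    exact: finite_basis_prod (finite_basis_R R) (finite_basis_rV R n).
  move=> y [[[cy dy] [_ d'y]] _]; split; first exact: cmap_cimg.
  by rewrite /loc /= cmapK.
have h3 := Ck_comp (finite_basis_rV R n) Uo _ h2 (gs' d' e ad' ae k).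
have yE y : U y -> cinv d (cmap d (f (cinv c y.2))) = f (cinv c y.2).
  by move=> [[[_ dy] _] _]; rewrite cmapK.
apply: eq_Ck (h3 _) => // y Uy; rewrite /loc /= yE //.
  by move: Uy => [[_ [_ d'y]] _]; rewrite cmapK.
by move: Uy => [[_ [_ d'y]] [_ ey]]; split; [exact: cmap_cimg|rewrite /= cmapK].
Qed.

(** The inverse [g] is symplectic and (F o f) o g = F, so [g] carries X_F to X_(F o f) and integral
    curves to integral curves. *)
Lemma effective_circle_transport n (M N : manifold R n) (w : symplectic_form M)
    (w' : symplectic_form N) (f : M -> N) (g : N -> M) (F : N -> R)
    (th : R -> N -> N) :
  symplectomorphism w w' f -> smooth_map g -> cancel f g -> cancel g f ->
  smooth_fun F -> effective_circle_moment w' F th ->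
  effective_circle_moment w (F \o f) (fun t p => g (th t (f p))).
Proof.
move=> fS gs fK gK Fs [[th0 thD thP] thS thI thE].
have [fs _ _] := fS; have [gc _] := gs.
have gS := symplectomorphism_inv fS gs fK gK.
split.
- split=> [p|s t p|p]; first by rewrite th0 fK.
    by rewrite gK thD.
  by rewrite thP fK.
- exact: (smooth_flow_transport fs gs thS).
- move=> p; have [Ic Id] := thI (f p); split.
    by move=> t; apply: (@continuous_comp _ _ _ _ g); [exact: Ic|exact: gc].
  move=> t c ac cgt; have [d ad dt] := atlas_cover (th t (f p)).
  have := is_derive_chart (h := cmap c \o g) (Ic t) dt (Id t d ad dt)
    (smooth_map_diff gs ad ac dt cgt).
  have Ffs : smooth_fun (F \o f) by exact: smooth_fun_comp.
  have := symplectomorphism_ham_vf gS Ffs ad ac dt cgt.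
  have -> : (F \o f) \o g = F by apply/funext => x /=; rewrite gK.
  by move=> <-.
- move=> t ht; apply: thE => q; rewrite -[RHS](gK q) -[g q in RHS]ht.
  by rewrite !gK.
Qed.

End transport.

(** * Hamiltonian flows *)

Section flows.
Variable R : realType.

(** What remains of a Hamiltonian circle action once periodicity and effectiveness are dropped. The
    flow is part of the data, so no existence theorem for integral curves enters. *)
Definition ham_flow n (M : manifold R n) (w : symplectic_form M) (F : M -> R)
    (th : R -> M -> M) :=
  [/\ forall p, th 0 p = p, forall s t p, th (s + t) p = th s (th t p),
      smooth_flow th & forall p, integral_curve w F (th^~ p)].

Lemma effective_ham_flow n (M : manifold R n) (w : symplectic_form M)
  (F : M -> R) th : effective_circle_moment w F th -> ham_flow w F th.
Proof. by move=> [[th0 thD _] thS thI _]. Qed.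

Lemma continuous_pairing (S T U : topologicalType) (f : S -> T) (g : S -> U) :
  continuous f -> continuous g -> continuous (fun y => (f y, g y)).
Proof. by move=> hf hg x; exact: cvg_pair (hf x) (hg x). Qed.

Lemma continuous_pair_l (S T : topologicalType) (x : T) :
  continuous (fun y : S => (y, x)).
Proof. by apply: continuous_pairing => y; [exact: cvg_id|exact: cst_continuous]. Qed.

Lemma continuous_pair_r (S T : topologicalType) (x : S) :
  continuous (fun y : T => (x, y)).
Proof. by apply: continuous_pairing => y; [exact: cst_continuous|exact: cvg_id]. Qed.

Section one_flow.
Variables (n : nat) (M : manifold R n) (w : symplectic_form M) (F : M -> R).
Variable th : R -> M -> M.
Hypotheses (Fs : smooth_fun F) (thF : ham_flow w F th).

Let th0 p : th 0 p = p. Proof. by case: thF. Qed.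
Let thD s t p : th (s + t) p = th s (th t p). Proof. by case: thF. Qed.
Let thS : smooth_flow th. Proof. by case: thF. Qed.
Let thI p : integral_curve w F (th^~ p). Proof. by case: thF. Qed.

Lemma flowK t : cancel (th t) (th (- t)).
Proof. by move=> p; rewrite -thD addNr th0. Qed.

Lemma flow_smooth t : smooth_map (th t).
Proof.
have [thc ths] := thS; split.
  move=> p; apply: (@continuous_comp _ _ _ (fun p => (t, p))
    (fun z : R * M => th z.1 z.2)); last exact: thc.
  exact: continuous_pair_r.
move=> c d ac ad k.
have Uo : open [set x | cimg c x /\ cdom d (th t (cinv c x))].
  apply: continuous_chart_dom => p.
  apply: (@continuous_comp _ _ _ (fun p => (t, p))
    (fun z : R * M => th z.1 z.2)); last exact: thc.
  exact: continuous_pair_r.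
have hl : Ck k [set x | cimg c x /\ cdom d (th t (cinv c x))] (@id 'rV[R]_n).
  by apply: Ck_linear => // x; exact: cvg_id.
have h1 := Ck_pair Uo (Ck_cst k _ t) hl.
exact: (Ck_comp (finite_basis_prod (finite_basis_R R) (finite_basis_rV R n))
  Uo (fun x Ux => Ux) h1 (ths c d ac ad k)).
Qed.

Section at_point.
Variables (c : chart R M n) (p : M).
Hypotheses (ac : atlas c) (cp : cdom c p).

(** Time and position form a single variable, so that exchanging their derivatives is an instance of
    Schwarz's theorem. *)
Let G (z : R * 'rV[R]_n) := cmap c (th z.1 (cinv c z.2)).
Let O := prod_chart_dom th c c.

Let Oo : open O.
Proof. by apply: open_prod_chart_dom; case: thS. Qed.

Let O0 : O (0, cmap c p).
Proof. by split; [exact: cmap_cimg|rewrite /= cmapK // th0]. Qed.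

Let GS k : Ck k O G.
Proof. by case: thS => _ /(_ c c ac ac k). Qed.

Let dG z : O z -> differentiable G z.
Proof. by move=> Oz; have [+ _] := GS 1; apply. Qed.

Let is_diff_slice_l (W : normedModType R) (g : R * 'rV[R]_n -> W) (t : R) x :
  differentiable g (t, x) ->
  is_diff t (fun s => g (s, x)) (fun s => 'd g (t, x) (s, 0)).
Proof.
move=> dg.
have h : is_diff t (fun s : R => (s, x)) (fun s => (s, 0)).
  exact: is_diff_pair (is_diff_id _) (is_diff_cst _ _).
exact: (is_diff_comp h (differentiableP dg)).
Qed.

Let is_diff_slice_r (W : normedModType R) (g : R * 'rV[R]_n -> W) (t : R) x :
  differentiable g (t, x) ->
  is_diff x (fun y => g (t, y)) (fun v => 'd g (t, x) (0, v)).
Proof.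
move=> dg.
have h : is_diff x (fun y : 'rV[R]_n => (t, y)) (fun v => (0, v)).
  exact: is_diff_pair (is_diff_cst _ _) (is_diff_id _).
exact: (is_diff_comp h (differentiableP dg)).
Qed.

Let near_slice_l : \forall t \near 0, O (t, cmap c p).
Proof.
have h : {for 0, continuous (fun t : R => (t, cmap c p))}.
  exact: continuous_pair_l.
exact: (h _ (open_near Oo O0)).
Qed.

Let near_slice_r : \forall x \near cmap c p, O (0, x).
Proof.
have h : {for cmap c p, continuous (fun x : 'rV[R]_n => (0 : R, x))}.
  exact: continuous_pair_r.
exact: (h _ (open_near Oo O0)).
Qed.

Let DtG z : O z -> 'D_(1, 0) G z = ham_vf w c F (G z).
Proof.
case: z => t x [/= cx ct]; have [_ /(_ t c ac ct) [_ <-]] := thI (cinv c x).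
have Oz : O (t, x) by [].
have h := is_diff_slice_l (dG Oz).
apply: esym; apply: etrans (@is_diff_derive R R _ _ _ _ 1 h) _.
by apply: esym; apply: deriveE; exact: dG.
Qed.

Let DtG0 : \forall x \near cmap c p, 'D_(1, 0) G (0, x) = ham_vf w c F x.
Proof.
apply: filterS near_slice_r => x Ox; rewrite DtG //; congr ham_vf.
by case: Ox => cx _; rewrite /G /= th0 cinvK.
Qed.

(** Near the point X_F is the time derivative of [G] at time 0, and inherits its regularity from the
    flow. *)
Let is_diff_ham_vf : is_diff (cmap c p) (ham_vf w c F)
  (fun v => 'd ('D_(1, 0) G) (0, cmap c p) (0, v)).
Proof.
apply: near_is_diff DtG0 _; apply: is_diff_slice_r.
by have [_ /(_ (1, 0)) [+ _]] := GS 2; apply.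
Qed.

Lemma ham_vf_differentiable : differentiable (ham_vf w c F) (cmap c p).
Proof. by have [] := is_diff_ham_vf. Qed.

(** The variational equation at time 0: the time derivative of the space derivative of [G] is the
    space derivative of its time derivative X_F. *)
Lemma is_derive_flow_diff v :
  is_derive (0 : R) 1 (fun h => 'd (loc (th h) c c) (cmap c p) v)
    ('D_v (ham_vf w c F) (cmap c p)).
Proof.
have GE : \forall h \near (0 : R),
    'D_(0, v) G (h, cmap c p) = 'd (loc (th h) c c) (cmap c p) v.
  apply: filterS near_slice_l => h Oh.
  apply: etrans (deriveE _ (dG Oh)) _; apply: esym.
  by have [_ E] := is_diff_slice_r (dG Oh); exact: (congr1 (fun f => f v) E).
apply: near_eq_is_derive GE _.
have d0 : differentiable ('D_(0, v) G) (0, cmap c p).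
  by have [_ /(_ (0, v)) [+ _]] := GS 2; apply.
have d1 : differentiable ('D_(1, 0) G) (0, cmap c p).
  by have [_ /(_ (1, 0)) [+ _]] := GS 2; apply.
have := @is_diff_is_derive R R _ _ _ _ 1 (is_diff_slice_l d0).
rewrite (_ : 'd _ _ _ = 'D_v (ham_vf w c F) (cmap c p)) //.
apply: etrans (esym (deriveE _ d0)) _.
apply: etrans (Schwarz _ _ Oo O0 (GS 2)) _.
apply: etrans (deriveE _ d1) _.
by apply: esym; exact: (is_diff_derive v is_diff_ham_vf).
Qed.

(** The backward flow contributes -X and the curve contributes X. At the instant s = t the flow map
    is the identity, so [X] passes through its differential unchanged. *)
Lemma is_derive_reverse_flow (g : R -> M) (t : R) : integral_curve w F g ->
  g t = p -> is_derive t 1 (cmap c \o (fun s => th (t - s) (g s))) 0.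
Proof.
move=> [gc gI] gt.
have cg : cdom c (g t) by rewrite gt.
have [/derivable1_diffP dg gv] := gI t c ac cg.
have h : is_diff t (fun s => (t - s, (cmap c \o g) s))
    (fun s => (0 - s, 'd (cmap c \o g) t s)).
  exact: is_diff_pair (differentiableP dg).
have dG0 : differentiable G (t - t, (cmap c \o g) t).
  by apply: dG; rewrite subrr /= gt; exact: O0.
have := @is_diff_is_derive R R _ _ _ _ 1 (is_diff_comp h (differentiableP dG0)).
rewrite /= subrr gt.
rewrite (_ : 'd G _ _ = 0).
  apply: near_eq_is_derive.
  have gs : \forall s \near t, cdom c (g s) by exact: (gc t) (near_cdom cg).
  by apply: filterS gs => s cs; rewrite /G /= cmapK.
have dG1 := dG O0.
rewrite sub0r.
have -> : 'd (cmap c \o g) t 1 = ham_vf w c F (cmap c p).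
  by rewrite -gt -gv; apply: esym; exact: deriveE.
set X := ham_vf _ _ _ _.
have -> : (-1, X) = - (1, 0) + (0, X) :> R * 'rV[R]_n.
  by apply/pair_equal_spec; rewrite /= ?oppr0 ?addr0 ?add0r.
rewrite linearD linearN.
have -> : 'd G (0, cmap c p) (1, 0) = X.
  apply: etrans (esym (deriveE _ dG1)) _.
  exact: nbhs_singleton DtG0.
suff -> : 'd G (0, cmap c p) (0, X) = X by rewrite addNr.
have [_ E] := is_diff_slice_r dG1.
apply: etrans (esym (congr1 (fun f => f X) E)) _.
have idE : (fun y => G (0, y)) = loc id c c.
  by apply/funext => x; rewrite /G /loc /= th0.
exact: etrans (congr1 (fun f => 'd f (cmap c p) X) idE) (diff_loc_id X cp).
Qed.

End at_point.
End one_flow.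
End flows.

(** * Infinitesimal invariance of the symplectic form *)

Section symplectic_flow.
Variable R : realType.

Lemma is_derive_entry (V : normedModType R) m n (A : V -> 'M[R]_(m, n))
    (dA : 'M[R]_(m, n)) x v i j :
  is_derive x v A dA -> is_derive x v (fun y => A y i j) (dA i j).
Proof.
move=> [Ad <-]; split; first by move/derivable_mxP: Ad; apply.
by apply: esym; exact: derive_entry.
Qed.

Lemma bilinE n (A : 'M[R]_n) u v :
  bilin A u v = \sum_i \sum_j u 0 i * A i j * v 0 j.
Proof.
rewrite /bilin mxE exchange_big /=; apply: eq_bigr => j _.
by rewrite !mxE mulr_suml.
Qed.

Lemma is_derive_bilin (V : normedModType R) n (A : V -> 'M[R]_n)
    (a b : V -> 'rV[R]_n) x v dA da db :
  is_derive x v A dA -> is_derive x v a da -> is_derive x v b db ->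
  is_derive x v (fun y => bilin (A y) (a y) (b y))
    (bilin dA (a x) (b x) + bilin (A x) da (b x) + bilin (A x) (a x) db).
Proof.
move=> hA ha hb.
have -> : (fun y => bilin (A y) (a y) (b y)) =
   \sum_i \sum_j (fun y => a y 0 i * A y i j * b y 0 j).
  apply/funext => y; rewrite bilinE fct_sumE; apply: eq_bigr => i _.
  by rewrite fct_sumE.
apply: is_derive_eq.
  apply: is_derive_sum => i; apply: is_derive_sum => j.
  exact: is_deriveM (is_deriveM (is_derive_entry 0 i ha) (is_derive_entry i j hA))
    (is_derive_entry 0 j hb).
rewrite !bilinE -!big_split; apply: eq_bigr => i _ /=.
rewrite -!big_split; apply: eq_bigr => j _ /=.
rewrite !fctE /GRing.scale /=; ring.
Qed.

Lemma bilin0l n (A : 'M[R]_n) v : bilin A 0 v = 0.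
Proof. by rewrite /bilin !mul0mx mxE. Qed.

Lemma bilin0r n (A : 'M[R]_n) u : bilin A u 0 = 0.
Proof. by rewrite /bilin trmx0 mulmx0 mxE. Qed.

Lemma bilin_skew n (A : 'M[R]_n) u v : A^T = - A -> bilin A u v = - bilin A v u.
Proof.
move=> AT; have -> : bilin A u v = (u *m A *m v^T)^T 0 0 by rewrite mxE.
rewrite !trmx_mul trmxK AT mulNmx mulmxN mulmxA.
by rewrite /bilin mxE.
Qed.

Lemma ham_vfE n (M : manifold R n) (w : symplectic_form M) (F : M -> R) c x v :
  atlas c -> cimg c x -> differentiable (F \o cinv c) x ->
  bilin (sform w c x) (ham_vf w c F x) v = 'D_v (F \o cinv c) x.
Proof.
move=> ac cx dF; apply: etrans _ (esym (deriveE _ dF)).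
by have [/(_ erefl)] := ham_vfP w (ham_vf w c F x) ac cx dF.
Qed.

(** The linear algebra of Cartan's formula: [k], [bu], [bv] come from derivatives of the form along
    X, u, v, [du] and [dv] from derivatives of X, and [r] is the mixed second derivative of F. *)
Let cartan_combine (k bu bv du dv r : R) :
  k + - bu + bv = 0 -> bu + du = r -> bv + dv = r -> k + du + - dv = 0.
Proof. lra. Qed.

(* Cartan's formula: both w and i_X w = dF are closed. *)
Lemma lie_derivative_ham_vf n (M : manifold R n) (w : symplectic_form M)
    (F : M -> R) c p u v :
  smooth_fun F -> atlas c -> cdom c p ->
  differentiable (ham_vf w c F) (cmap c p) ->
  let x := cmap c p in let X := ham_vf w c F in
  bilin ('D_(X x) (sform w c) x) u v + bilin (sform w c x) ('D_u X x) v +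
  bilin (sform w c x) u ('D_v X x) = 0.
Proof.
move=> Fs ac cp dX x X.
have cx : cimg c x by exact: cmap_cimg.
have co : open (cimg c) by exact: cimg_open.
have dW a : is_derive x a (sform w c) ('D_a (sform w c) x).
  apply: derivableP; apply: diff_derivable.
  by have [+ _] := sform_smooth w ac 1; apply.
have dXd a : is_derive x a X ('D_a X x).
  by apply: derivableP; apply: diff_derivable.
have DW a b b' : is_derive x a (fun y => bilin (sform w c y) b b')
    (bilin ('D_a (sform w c) x) b b').
  have := is_derive_bilin (dW a) (is_derive_cst b x a) (is_derive_cst b' x a).
  by rewrite bilin0l bilin0r !addr0.
have DWE a b b' : 'D_a (fun y => bilin (sform w c y) b b') x =
    bilin ('D_a (sform w c) x) b b' by have [] := DW a b b'.
have skew a b b' : bilin ('D_a (sform w c) x) b b' =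
    - bilin ('D_a (sform w c) x) b' b.
  have near_skew : \forall y \near x,
      - bilin (sform w c y) b' b = bilin (sform w c y) b b'.
    apply: filterS (near_cimg cx) => y cy; apply: esym; apply: bilin_skew.
    exact: sform_skew.
  have [_ <-] := near_eq_is_derive near_skew (is_deriveN (DW a b' b)).
  by have [_ <-] := DW a b b'.
(* Differentiate the identity w(X, b) = D_b F in the direction [a]. *)
have H a b : bilin ('D_a (sform w c) x) (X x) b + bilin (sform w c x) ('D_a X x) b =
    'D_a ('D_b (F \o cinv c)) x.
  have [_ E] := is_derive_bilin (dW a) (dXd a) (is_derive_cst b x a).
  move: E; rewrite bilin0r addr0 => <-; apply: near_eq_derive.
  apply: filterS (near_cimg cx) => y cy; apply: ham_vfE => //.
  by have [+ _] := Fs c ac 1%N; apply.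
have S := Schwarz_real u v co cx (Fs c ac 2%N).
(* Closedness is stated for constant vectors, so it is applied to the value of X at [x], held
   fixed. *)
have C : bilin ('D_(X x) (sform w c) x) u v +
    - bilin ('D_u (sform w c) x) (X x) v +
    bilin ('D_v (sform w c) x) (X x) u = 0.
  apply: etrans (sform_closed w ac cx (X x) u v).
  apply: congr2 (esym (DWE v (X x) u)).
  apply: congr2 (esym (DWE (X x) u v)) _.
  exact: etrans (esym (skew u v (X x))) (esym (DWE u v (X x))).
have -> : bilin (sform w c x) u ('D_v X x) = - bilin (sform w c x) ('D_v X x) u.
  by apply: bilin_skew; exact: sform_skew.
exact: (cartan_combine C (H u v) (etrans (H v u) (esym S))).
Qed.

End symplectic_flow.

(** * Invariance, uniqueness and commutation of flows *)

Section flow_invariance.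
Variable R : realType.

Lemma is_derive_comp_curve (V W : normedModType R) (g : R -> V) (f : V -> W) (t : R) (v : V) :
  is_derive t 1 g v -> differentiable f (g t) ->
  is_derive t 1 (f \o g) ('D_v f (g t)).
Proof.
move=> [/derivable1_diffP dg gv] df.
have h := is_diff_comp (differentiableP dg) (differentiableP df).
have := @is_diff_is_derive R R W _ _ _ 1 h.
have -> // : ('d f (g t) \o 'd g t) 1 = 'D_v f (g t).
rewrite /= -gv; apply: etrans _ (esym (deriveE _ df)).
by congr ('d f (g t) _); apply: esym; exact: deriveE.
Qed.

Lemma is_derive_translate (W : normedModType R) (f : R -> W) (s : R) (v : W) :
  is_derive (0 : R) 1 f v -> is_derive s 1 (fun t => f (t - s)) v.
Proof.
move=> [/derivable1_diffP df <-].
have h : is_derive s 1 (fun t : R => t - s) 1.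
  have [d1 d2] := is_deriveB (is_derive_id s 1) (is_derive_cst s s 1).
  by split; [exact: d1|rewrite [LHS]d2 subr0].
have df' : differentiable f (s - s) by rewrite subrr.
by have := is_derive_comp_curve h df'; rewrite subrr.
Qed.

Definition chart_at n (M : manifold R n) (p : M) : chart R M n :=
  sval (cid2 (atlas_cover p)).

Lemma chart_at_atlas n (M : manifold R n) (p : M) : atlas (chart_at p).
Proof. by rewrite /chart_at; case: cid2. Qed.

Lemma chart_at_dom n (M : manifold R n) (p : M) : cdom (chart_at p) p.
Proof. by rewrite /chart_at; case: cid2. Qed.

Lemma chart_differentiable_continuous n (M : manifold R n) (F : M -> R) :
  (forall p, differentiable (F \o cinv (chart_at p)) (cmap (chart_at p) p)) ->
  continuous F.
Proof.
move=> dF p; have cp := chart_at_dom p.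
have := continuous_comp (cmap_cont cp) (differentiable_continuous (dF p)).
apply: near_continuous; apply: filterS (near_cdom cp) => q cq /=.
by rewrite cmapK.
Qed.

Lemma zero_derivative_constant (V : normedModType R) (f : V -> R) x r :
  (forall y, ball x r y -> differentiable f y) ->
  (forall y v, ball x r y -> 'D_v f y = 0) ->
  forall y, ball x r y -> f y = f x.
Proof.
move=> df Df y xy; have seg s : 0 <= s <= 1 -> ball x r (x + s *: (y - x)).
  move=> /andP[s0 s1]; move: xy; rewrite -!ball_normE /= => xy.
  rewrite opprD addrA subrr add0r normrN normrZ ger0_norm // distrC.
  by apply: le_lt_trans xy; rewrite ler_piMl.
have [|c c01] := line_MVT (w := y - x) (f := f) ler01 (x := x).
  by move=> s /seg/df.
rewrite Df; last exact: seg.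
by rewrite scale1r subrKC mulr0 => /eqP; rewrite subr_eq0 => /eqP.
Qed.

Lemma connected_clopen (T : topologicalType) (A : set T) :
  connected [set: T] -> open A -> closed A -> A !=set0 -> forall x, A x.
Proof.
move=> Tc Ao Ac A0 x; have -> // : A = setT.
by apply: Tc => //; exists A; rewrite ?setTI.
Qed.

(** The chart in the hypothesis varies with [t]; a change of charts brings nearby velocities into
    one chart, where the coordinates are constant. The set where g = g(0) is thus open, and it is
    closed because M is Hausdorff. *)
Lemma locally_constant_curve n (M : manifold R n) (g : R -> M) : continuous g ->
  (forall t : R, is_derive t 1 (cmap (chart_at (g t)) \o g) 0) ->
  forall t, g t = g 0.
Proof.
move=> gc g0; apply: (@connected_clopen R [set t | g t = g 0]).
- by apply/connected_intervalP => x y _ _ z.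
- rewrite openE => t0 /= gt0; set d := chart_at (g t0).
  have ad : atlas d := chart_at_atlas _; have dt0 : cdom d (g t0) := chart_at_dom _.
  have : \forall t \near t0, cdom d (g t) by exact: (gc t0) (near_cdom dt0).
  move=> /nbhs_ballP[r /= r0 rP]; apply/nbhs_ballP; exists r => // t tr /=.
  rewrite -gt0.
  suff E : cmap d (g t) = cmap d (g t0).
    by rewrite -(cmapK (rP _ tr)) -(cmapK dt0) E.
  apply/rowP => i.
  have D s : ball t0 r s -> is_derive s 1 (fun s => (cmap d \o g) s 0 i) 0.
    move=> sr; have ds := rP _ sr.
    have cs := chart_at_dom (g s); have as' := chart_at_atlas (g s).
    have := is_derive_chart (gc s) cs (g0 s)
      (smooth_map_diff (smooth_map_id M) as' ad cs ds).
    by rewrite linear0 => /(is_derive_entry 0 i); rewrite mxE.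
  apply: (zero_derivative_constant (f := fun s => (cmap d \o g) s 0 i) _ _ tr).
    by move=> s /D[/derivable1_diffP].
  move=> s v /D[/derivable1_diffP ds d0].
  apply: etrans (deriveE _ ds) _.
  have {1}-> : v = v *: (1 : R) by rewrite /GRing.scale /= mulr1.
  rewrite linearZ; have -> : 'd (fun s => (cmap d \o g) s 0 i) s 1 = 0.
    by apply: etrans (esym (deriveE _ ds)) d0.
  exact: scaler0.
- apply: (@closed_comp _ _ g [set g 0]); first by move=> t _; exact: gc.
  exact: accessible_closed_set1 (hausdorff_accessible (@manifold_hausdorff _ _ M)) _.
- by exists 0.
Qed.

Section one_flow.
Variables (n : nat) (M : manifold R n) (w : symplectic_form M) (F : M -> R).
Variable th : R -> M -> M.
Hypotheses (Fs : smooth_fun F) (thF : ham_flow w F th).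

(** The pulled-back form has zero derivative in the time: the group law moves the derivative at [s0]
    to time 0, where it is the Lie derivative of the form. *)
Lemma flow_pullback s c d p u v : atlas c -> atlas d -> cdom c p ->
  cdom d (th s p) ->
  bilin (sform w d (cmap d (th s p)))
    ('d (loc (th s) c d) (cmap c p) u) ('d (loc (th s) c d) (cmap c p) v) =
  bilin (sform w c (cmap c p)) u v.
Proof.
move=> ac ad cp dp; have [th0 thD _ thI] := thF.
pose E s d q (a b : 'rV[R]_n) c p := bilin (sform w d (cmap d q))
  ('d (loc (th s) c d) (cmap c p) a) ('d (loc (th s) c d) (cmap c p) b).
(* The target chart must follow the moving point; by [BE] the value does not depend on its
   choice. *)
pose B s := E s (chart_at (th s p)) (th s p) u v c p.
have BE s' d' : atlas d' -> cdom d' (th s' p) -> B s' = E s' d' (th s' p) u v c p.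
  move=> ad' dp'; rewrite /B /E.
  have ad'' := chart_at_atlas (th s' p); have dp'' := chart_at_dom (th s' p).
  apply: etrans (sform_compat w ad'' ad' dp'' dp' _ _) _.
  have H z := diff_loc_comp (flow_smooth thF s') (smooth_map_id M) ac ad'' ad'
    cp dp'' dp' z.
  by congr bilin; apply: esym; exact: H.
have dB (s0 : R) : is_derive s0 1 B 0.
  set q := th s0 p; set d0 := chart_at q.
  have ad0 : atlas d0 := chart_at_atlas q; have dq : cdom d0 q := chart_at_dom q.
  pose a := 'd (loc (th s0) c d0) (cmap c p) u.
  pose b := 'd (loc (th s0) c d0) (cmap c p) v.
  have Bn : \forall s \near s0,
      E (s - s0) d0 (th (s - s0) q) a b d0 q = B s.
    have [cI _] := thI p.
    have sd : \forall s \near s0, cdom d0 (th s p) by exact: (cI s0) (near_cdom dq).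
    apply: filterS sd => t dt; rewrite (BE _ _ ad0 dt) /E.
    have tq : th (t - s0) q = th t p by rewrite /q -thD subrK.
    have tE : th t = th (t - s0) \o th s0.
      by apply/funext => r; rewrite /= -thD subrK.
    rewrite tq.
    have dt' : cdom d0 (th (t - s0) (th s0 p)) by rewrite -/q tq.
    have H z : 'd (loc (th t) c d0) (cmap c p) z =
       'd (loc (th (t - s0)) d0 d0) (cmap d0 q) ('d (loc (th s0) c d0) (cmap c p) z).
      rewrite tE; exact: (diff_loc_comp (flow_smooth thF s0)
        (flow_smooth thF (t - s0)) ac ad0 ad0 cp dq dt').
    by congr bilin; apply: esym; exact: H.
  apply: near_eq_is_derive Bn _.
  apply: (is_derive_translate (f := fun h => E h d0 (th h q) a b d0 q)).
  have [cq /(_ 0 d0 ad0)] := thI q; rewrite th0 => /(_ dq) dq0.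
  have dW : differentiable (sform w d0) ((cmap d0 \o th^~ q) 0).
    have [+ _] := sform_smooth w ad0 1; apply; rewrite /= th0; exact: cmap_cimg.
  have dA := is_derive_comp_curve dq0 dW.
  have D0 z : 'd (loc (th 0) d0 d0) (cmap d0 q) z = z.
    have -> : th 0 = id by apply/funext => r; exact: th0.
    exact: diff_loc_id.
  pose X := ham_vf w d0 F; pose W := sform w d0; pose y := cmap d0 q.
  (* The product rule produces the point and vectors transported by [th 0]; these are equal to [y],
     [a], [b] but not convertible to them. *)
  have key y' a' b' : y' = y -> a' = a -> b' = b ->
      bilin ('D_(X y) W y') a' b' + bilin (W y') ('D_a X y) b' +
      bilin (W y') a' ('D_b X y) = 0.
    move=> -> -> ->.
    exact: (lie_derivative_ham_vf a b Fs ad0 dq (ham_vf_differentiable thF ad0 dq)).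
  have [dd de] := is_derive_bilin dA (is_derive_flow_diff thF ad0 dq a)
    (is_derive_flow_diff thF ad0 dq b).
  split; first exact: dd.
  apply: etrans de (key _ _ _ _ (D0 a) (D0 b)).
  by rewrite /= th0.
have B0 : B s = B 0 by exact: is_derive_0_is_cst.
rewrite -/(E s d (th s p) u v c p) -(BE s d ad dp) B0.
have c0 : cdom c (th 0 p) by rewrite th0.
rewrite (BE 0 c ac c0) /E.
have -> : th 0 = id by apply/funext => r; exact: th0.
by rewrite !(diff_loc_id _ cp).
Qed.

Lemma flow_symplectic s : symplectomorphism w w (th s).
Proof.
split; first exact: (flow_smooth thF).
  exists (th (- s)); split; first exact: (flow_smooth thF).
    exact: flowK thF _.
  by have := flowK thF (- s); rewrite opprK.
by move=> c d p ac ad cp dp u v /=; exact: flow_pullback.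
Qed.

Lemma flow_conserves (K : M -> R) s p : smooth_fun K ->
  poisson_commute w K F -> K (th s p) = K p.
Proof.
move=> Ks KF; have [th0 thD _ thI] := thF.
rewrite -[in RHS](th0 p); apply: (is_derive_0_is_cst (f := K \o th^~ p)) => t.
have [Ic Id] := thI p.
have ac := chart_at_atlas (th t p); have cp := chart_at_dom (th t p).
have dK := smooth_fun_diff Ks ac cp.
have cx := cmap_cimg cp.
have := is_derive_chart (Ic t) cp (Id t _ ac cp) dK.
have -> // : 'd (K \o cinv (chart_at (th t p))) (cmap (chart_at (th t p)) (th t p))
   (ham_vf w (chart_at (th t p)) F (cmap (chart_at (th t p)) (th t p))) = 0.
apply: etrans (esym (deriveE _ dK)) _.
apply: etrans (esym (ham_vfE w _ ac cx dK)) _.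
exact: KF.
Qed.

(** Unwinding [g] by the flow gives a curve of zero velocity: near [s] it is the fixed map
    [th (- s)] applied to the curve of [is_derive_reverse_flow]. *)
Lemma integral_curve_unique (g : R -> M) t : integral_curve w F g ->
  g t = th t (g 0).
Proof.
move=> gI; have [th0 thD [thc _] thI] := thF; have [gc _] := gI.
pose dl t := th (- t) (g t).
suff dlE : dl t = dl 0.
  have := congr1 (th t) dlE; rewrite /dl oppr0 th0 => <-.
  by rewrite -thD subrr th0.
apply: locally_constant_curve.
  move=> s; apply: (@continuous_comp _ _ _ (fun t => (- t, g t))
    (fun z : R * M => th z.1 z.2)); last exact: thc.
  by apply: continuous_pairing => //; exact: opp_continuous.
move=> s; set d := chart_at _; set q := g s.
have ac := chart_at_atlas q; have cq := chart_at_dom q.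
have ad : atlas d := chart_at_atlas _; have dq : cdom d (th (- s) q) := chart_at_dom _.
have h := is_derive_reverse_flow thF ac cq gI (erefl q).
have ec : {for s, continuous (fun t => th (s - t) (g t))}.
  apply: (@continuous_comp _ _ _ (fun t => (s - t, g t))
    (fun z : R * M => th z.1 z.2)); last exact: thc.
  apply: continuous_pairing => // x.
  by apply: (@continuousB _ _ _ (cst s) id x); [exact: cst_continuous|exact: cvg_id].
have cq' : cdom (chart_at q) (th (s - s) (g s)) by rewrite subrr th0.
have dd : differentiable ((cmap d \o th (- s)) \o cinv (chart_at q))
    (cmap (chart_at q) (th (s - s) (g s))).
  rewrite subrr th0; exact: (smooth_map_diff (flow_smooth thF (- s)) ac ad cq dq).
have := is_derive_chart ec cq' h dd.
rewrite linear0; apply: near_eq_is_derive; near=> t0.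
by rewrite /= -thD addrA addNr add0r.
Unshelve. all: by end_near. Qed.

End one_flow.

(** [thF s] preserves both the form and [K], hence X_K; it maps integral curves of X_K to integral
    curves of X_K, and these are unique. *)
Lemma flows_commute n (M : manifold R n) (w : symplectic_form M) (F K : M -> R)
    thF thK s t p : smooth_fun F -> smooth_fun K ->
  ham_flow w F thF -> ham_flow w K thK -> poisson_commute w K F ->
  thF s (thK t p) = thK t (thF s p).
Proof.
move=> Fs Ks hF hK KF; have [thK0 _ _ thKI] := hK.
have [fc _] := flow_smooth hF s.
rewrite -{2}(thK0 p).
apply: (integral_curve_unique hK (g := fun t => thF s (thK t p))).
have [Ic Id] := thKI p; split.
  by move=> x; apply: (@continuous_comp _ _ _ (thK^~ p)); [exact: Ic|exact: fc].
move=> x d ad dx.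
have ac := chart_at_atlas (thK x p); have cx := chart_at_dom (thK x p).
have := is_derive_chart (h := cmap d \o thF s) (Ic x) cx (Id x _ ac cx)
  (smooth_map_diff (flow_smooth hF s) ac ad cx dx).
have := symplectomorphism_ham_vf (flow_symplectic Fs hF s) Ks ac ad cx dx.
have -> : K \o thF s = K by apply/funext => q; exact: (flow_conserves hF s q Ks KF).
by move=> <-.
Qed.

End flow_invariance.

(** * Maps of finite order *)

Section finite_order_maps.
Variables (R : realType) (n : nat) (M : manifold R n) (tau : M -> M) (N : nat).
Hypotheses (tauS : smooth_map tau) (N0 : (0 < N)%N).
Hypothesis tauN : forall p, iter N tau p = p.

(* If T = id + o(x) near a fixed point, then the increments T^(k+1) x - T^k x
   are almost equal; they add up to 0 over a period, so they vanish. *)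
Lemma finite_order_near_id q c : atlas c -> cdom c q -> tau q = q ->
  (forall v, 'd (loc tau c c) (cmap c q) v = v) -> \forall y \near q, tau y = y.
Proof.
move=> ac cq tq D1; have [tc tS] := tauS.
pose U := [set x | cimg c x /\ cdom c (tau (cinv c x))].
have Uo : open U by exact: continuous_chart_dom.
have Uq : U (cmap c q) by split; [exact: cmap_cimg|rewrite cmapK // tq].
have e0 : 0 < (2 ^+ N)^-1 :> R by rewrite invr_gt0 exprn_gt0.
have D1' v : 'D_v (loc tau c c) (cmap c q) = v.
  apply: etrans (deriveE _ _) (D1 v).
  by apply: (smooth_map_diff tauS) => //; rewrite tq.
have [r r0 hr] := strict_near_id Uo Uq (tS c c ac ac 1) D1' e0.
(* Only finitely many iterates occur, so a single neighbourhood of [q] keeps all of them in the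
   chart and in the ball where [tau] is close to the identity. *)
pose P (k : 'I_N.+1) y :=
  cdom c (iter k tau y) /\ ball (cmap c q) r (cmap c (iter k tau y)).
have nP : \forall y \near q, forall k, P k y.
  apply: (@filter_forall _ _ P (nbhs q)) => k.
  have kc : {for q, continuous (iter k tau)}.
    elim: (k : nat) => [|j IH]; first exact: cvg_id.
    by apply: (@continuous_comp _ _ _ (iter j tau) tau); [exact: IH|exact: tc].
  have kq : iter k tau q = q by elim: (k : nat) => //= j ->.
  have n1 : nbhs (iter k tau q) (cdom c) by rewrite kq; exact: near_cdom.
  have n2 : nbhs (iter k tau q) (fun y => ball (cmap c q) r (cmap c y)).
    rewrite kq; exact: (cmap_cont cq (nbhsx_ballx _ _ r0)).
  exact: filterI (kc _ n1) (kc _ n2).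
apply: filterS nP => y hP.
have P0 k : (k <= N)%N -> P (inord k) y by move=> _; exact: hP.
have Pk k : (k <= N)%N ->
    cdom c (iter k tau y) /\ ball (cmap c q) r (cmap c (iter k tau y)).
  by move=> kN; have := P0 k kN; rewrite /P inordK.
have TE k : (k <= N)%N ->
    iter k (loc tau c c) (cmap c y) = cmap c (iter k tau y).
  elim: k => // k IH kN; rewrite /= IH ?(ltnW kN) // /loc /= cmapK //.
  by have [] := Pk k (ltnW kN).
have cy : cdom c y by have [] := Pk 0%N isT.
have cty : cdom c (tau y) by have [] := Pk 1%N N0.
have := finite_order_fixed (T := loc tau c c) (x := cmap c y) N0 hr.
rewrite /loc /= cmapK // => E.
rewrite -(cmapK cty) E ?cmapK // => [k kN|].
  by rewrite -/(loc tau c c) TE //; have [] := Pk k kN.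
by rewrite -/(loc tau c c) TE // tauN.
Qed.

(** The interior of the fixed set is closed: at a limit point [tau] fixes the point and, by
    continuity, has identity differential, so [finite_order_near_id] applies again. *)
Lemma finite_order_id p c : connected [set: M] -> atlas c -> cdom c p ->
  tau p = p -> (forall v, 'd (loc tau c c) (cmap c p) v = v) ->
  forall q, tau q = q.
Proof.
move=> Mc ac cp tp D1 q; have [tc tS] := tauS.
pose S := [set q : M | \forall y \near q, tau y = y].
suff : S q by exact: nbhs_singleton.
apply: connected_clopen => //; first exact: open_interior.
  move=> z Sz; have tz : tau z = z.
    apply: (@manifold_hausdorff _ _ M) => A B hA hB.
    have hA' : nbhs z (tau @^-1` A) by exact: tc hA.
    have [y [Sy [Ay By]]] := Sz _ (filterI hA' hB).
    by exists y; split=> //; rewrite -(nbhs_singleton Sy).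
  set d := chart_at z; have ad : atlas d := chart_at_atlas z.
  have dz : cdom d z := chart_at_dom z.
  apply: (finite_order_near_id ad dz tz) => v; apply/eqP; apply: contrapT.
  (* Were [e] positive, the derivative along [v] would differ from [v] at all nearby points, yet it
     equals [v] at those of [S]. *)
  move=> /negP nv; pose e := `|'d (loc tau d d) (cmap d z) v - v|.
  have e0 : 0 < e by rewrite normr_gt0 subr_eq0.
  pose U := [set x | cimg d x /\ cdom d (tau (cinv d x))].
  have Uz : U (cmap d z) by split; [exact: cmap_cimg|rewrite cmapK // tz].
  have [dT cT] := tS d d ad ad 1.
  have nT : \forall x \near cmap d z,
      `|'D_v (loc tau d d) (cmap d z) - 'D_v (loc tau d d) x| < e.
    by have /cvgrPdist_lt/(_ _ e0) := cT v (cmap d z) Uz.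
  have nT' : \forall y \near z,
      `|'D_v (loc tau d d) (cmap d z) - 'D_v (loc tau d d) (cmap d y)| < e.
    exact: (cmap_cont dz nT).
  have [y [Sy [dy]]] := Sz _ (filterI (near_cdom dz) nT').
  have -> : 'D_v (loc tau d d) (cmap d z) = 'd (loc tau d d) (cmap d z) v.
    by apply: deriveE; apply: dT.
  suff -> : 'D_v (loc tau d d) (cmap d y) = v by rewrite ltxx.
  have -> : 'D_v (loc tau d d) (cmap d y) = 'D_v id (cmap d y).
    apply: near_eq_derive.
    have h : \forall x \near cmap d y, tau (cinv d x) = cinv d x.
      exact: (near_chart dy Sy).
    have h2 := near_cimg (cmap_cimg dy).
    by apply: filterS2 h h2 => x xE cx; rewrite /loc /= xE cinvK.
  exact: derive_id.
exists p; exact: (finite_order_near_id ac cp tp D1).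
Qed.

End finite_order_maps.

(** * Circle actions at a focus-focus point *)

Section rotations.
Variable R : realType.

Let is_derive_scale_comp (k : R) (f df : R -> R) (x : R) :
  (forall y : R, is_derive y 1 f (df y)) ->
  is_derive x 1 (fun t => f (k * t)) (k * df (k * x)).
Proof.
move=> fd; have h1 : is_derive x 1 (fun t : R => k * t) k.
  have [d1 d2] := is_deriveZ k (is_derive_id x (1 : R)).
  by split; [exact: d1|rewrite [LHS]d2 /GRing.scale /= mulr1].
by rewrite mulrC; exact: (is_derive1_comp (fd (k * x)) h1).
Qed.

(** With z = f + ig the system is z' = (b + ia) z. The functions [u] and [v] below are the real and
    imaginary parts of the constant of motion exp(-(b + ia) t) z. *)
Lemma spiral_ode (a b : R) (f g : R -> R) :
  (forall t : R, is_derive t 1 f (b * f t - a * g t)) ->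
  (forall t : R, is_derive t 1 g (a * f t + b * g t)) ->
  forall t, f t = expR (b * t) * (cos (a * t) * f 0 - sin (a * t) * g 0) /\
            g t = expR (b * t) * (sin (a * t) * f 0 + cos (a * t) * g 0).
Proof.
move=> fd gd t.
have dE (x : R) := is_derive_scale_comp (- b) x (@is_derive_expR R).
have dC (x : R) := is_derive_scale_comp a x (@is_derive_cos R).
have dS (x : R) := is_derive_scale_comp a x (@is_derive_sin R).
pose u x := expR (- b * x) * (cos (a * x) * f x + sin (a * x) * g x).
pose v x := expR (- b * x) * (cos (a * x) * g x - sin (a * x) * f x).
have du (x : R) : is_derive x 1 u 0.
  have [d1 d2] := is_deriveM (dE x) (is_deriveD (is_deriveM (dC x) (fd x))
     (is_deriveM (dS x) (gd x))).
  split; first exact: d1.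
  by rewrite [LHS]d2 /GRing.scale /= !fctE /=; ring.
have dv (x : R) : is_derive x 1 v 0.
  have [d1 d2] := is_deriveM (dE x) (is_deriveB (is_deriveM (dC x) (gd x))
     (is_deriveM (dS x) (fd x))).
  split; first exact: d1.
  by rewrite [LHS]d2 /GRing.scale /= !fctE /=; ring.
have uE : u t = f 0.
  rewrite (is_derive_0_is_cst t 0 du) /u !mulr0 expR0 cos0 sin0.
  by rewrite !mul1r mul0r addr0.
have vE : v t = g 0.
  rewrite (is_derive_0_is_cst t 0 dv) /v !mulr0 expR0 cos0 sin0.
  by rewrite !mul1r mul0r subr0.
have EE : expR (b * t) * expR (- b * t) = 1.
  by rewrite mulNr expRN mulfV // gt_eqF // expR_gt0.
have CS := cos2Dsin2 (a * t).
rewrite -uE -vE /u /v; set e := expR (b * t) in EE *.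
set e' := expR (- b * t) in EE *; set c := cos _ in CS *; set s := sin _ in CS *.
split.
  transitivity ((e * e') * (c ^+ 2 + s ^+ 2) * f t); last by ring.
  by rewrite EE CS !mul1r.
transitivity ((e * e') * (c ^+ 2 + s ^+ 2) * g t); last by ring.
by rewrite EE CS !mul1r.
Qed.

(** A fractional part [d] of |a| in (0, 1) would satisfy cos (2 pi d) = 1, hence sin (pi d) = 0,
    although 0 < pi d < pi. *)
Lemma cos_eq1_nat (a : R) : cos (a * (2 * pi)) = 1 -> exists N, `|a| = N%:R.
Proof.
move=> ca; have [N /andP[N1 N2]] : exists N : nat, N%:R <= `|a| < N.+1%:R.
  by exists (Num.truncn `|a|); exact: truncn_itv.
exists N; apply/eqP; rewrite eq_sym eq_le N1 leNgt; apply/negP => lt.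
pose d := `|a| - N%:R.
have d0 : 0 < d by rewrite subr_gt0.
have d1 : d < 1 by rewrite ltrBlDr addrC natr1.
have cd : cos (d * pi *+ 2) = 1.
  have -> : d * pi *+ 2 = `|a * (2 * pi)| - (pi *+ 2) *+ N.
    have -> : 2 * pi = pi *+ 2 :> R by rewrite mulr_natl.
    rewrite normrM (ger0_norm (mulrn_wge0 2 (pi_ge0 R))) /d.
    rewrite mulrBl mulrnBl [N%:R * _]mulr_natl [pi *+ N *+ 2]mulrnAC.
    by rewrite -mulrnAr.
  rewrite cosB.
  have p1 : cos (pi *+ 2 *+ N : R) = 1 /\ sin (pi *+ 2 *+ N : R) = 0.
    elim: N {N1 N2 lt d d0 d1} => [|N [IH1 IH2]]; first by rewrite mulr0n cos0 sin0.
    rewrite mulrS (cosD (pi *+ 2)) (sinD (pi *+ 2)) cos2pi sin2pi IH1 IH2.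
    by split; ring.
  have [-> ->] := p1; rewrite mulr1 mulr0 addr0.
  by case: (ger0P (a * (2 * pi))) => _; rewrite ?cosN.
have s0 : 0 < sin (d * pi).
  by rewrite sin_gt0_pi // mulr_gt0 ?pi_gt0 //= gtr_pMl ?pi_gt0.
have := cos2Dsin2 (d * pi); move: cd; rewrite cos_mulr2n.
move: s0; set s := sin _; set c := cos _ => s0 c1 c2.
nra.
Qed.

End rotations.

(** * Linear vector fields of focus-focus type *)

Section focus_focus_linearization.
Variable R : realType.

Lemma std_sformE m (u v : 'rV[R]_(m + m)) :
  bilin (std_sform R m) u v =
  \sum_i xc u i * yc v i - \sum_i yc u i * xc v i.
Proof.
rewrite /bilin -[u in LHS]hsubmxK -[v in LHS]hsubmxK /std_sform mul_row_block.
rewrite tr_row_mx mul_row_col !mulmx0 add0r addr0 mulmxN !mulmx1 mulNmx addrC.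
by rewrite !mxE -sumrN; congr (_ + _); last rewrite -sumrN; apply: eq_bigr => i _;
  rewrite !mxE.
Qed.

Lemma bilinDl n (A : 'M[R]_n) u u' v :
  bilin A (u + u') v = bilin A u v + bilin A u' v.
Proof. by rewrite /bilin !mulmxDl mxE. Qed.

Lemma bilinDr n (A : 'M[R]_n) u v v' :
  bilin A u (v + v') = bilin A u v + bilin A u v'.
Proof. by rewrite /bilin linearD /= mulmxDr mxE. Qed.

(** Membership in sp makes w(zC, v) symmetric in [z] and [v], so [C] can be recovered from its
    quadratic Hamiltonian. *)
Lemma sp_polarization m (C : 'M[R]_(m + m)) z v : sp C ->
  bilin (std_sform R m) (z *m C) v =
  sp_quad C (z + v) - sp_quad C z - sp_quad C v.
Proof.
move=> spC; pose b z v := bilin (std_sform R m) (z *m C) v.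
have skew u u' : bilin (std_sform R m) u u' = - bilin (std_sform R m) u' u.
  rewrite !std_sformE opprB; congr (_ - _);
  by apply: eq_bigr => i _; rewrite mulrC.
have sym : b v z = b z v.
  rewrite /b skew {1}/bilin trmx_mul !mulmxA -[_ *m C^T]mulmxA.
  have -> : std_sform R m *m C^T = - (C *m std_sform R m).
    by apply/eqP; rewrite -addr_eq0 addrC; apply/eqP.
  by rewrite mulmxN mulNmx mxE opprK mulmxA.
have bD a a' d d' : b (a + a') (d + d') = b a d + b a d' + b a' d + b a' d'.
  by rewrite /b mulmxDl !bilinDl !bilinDr addrA.
rewrite /sp_quad -/(b z v) -/(b (z + v) (z + v)) -/(b z z) -/(b v v) bD sym.
by field.
Qed.

Lemma ord2_ind (Q : 'I_2 -> Prop) : Q 0 -> Q 1 -> forall i, Q i.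
Proof.
move=> Q0 Q1 i; have [->//|i0] := eqVneq i 0; suff -> : i = 1 by [].
by apply/val_inj; case: i i0 => -[|[|k]].
Qed.

Lemma eq_coords m (z z' : 'rV[R]_(m + m)) :
  (forall i, xc z i = xc z' i) -> (forall i, yc z i = yc z' i) -> z = z'.
Proof.
move=> hx hy; apply/rowP => k.
by case: (split_ordP k) => i ->; [exact: hx|exact: hy].
Qed.

Lemma focus_focus_vector_field (C : 'M[R]_(2 + 2)) (a b : R) : sp C ->
  (forall z, sp_quad C z = a * (xc z 0 * yc z 1 - xc z 1 * yc z 0) +
     b * (xc z 0 * yc z 0 + xc z 1 * yc z 1)) ->
  forall z, [/\ xc (z *m C) 0 = b * xc z 0 - a * xc z 1,
    xc (z *m C) 1 = a * xc z 0 + b * xc z 1,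
    yc (z *m C) 0 = - b * yc z 0 - a * yc z 1 &
    yc (z *m C) 1 = a * yc z 0 + - b * yc z 1].
Proof.
move=> spC qC z.
have E v := etrans (esym (std_sformE (z *m C) v)) (sp_polarization z v spC).
have dx i k : xc (delta_mx 0 (lshift 2 i) : 'rV[R]_(2 + 2)) k = (k == i)%:R.
  by rewrite /xc mxE /= (inj_eq (@lshift_inj _ _)).
have dy i k : yc (delta_mx 0 (lshift 2 i) : 'rV[R]_(2 + 2)) k = 0.
  by rewrite /yc mxE /= eq_rlshift.
have ex i k : xc (delta_mx 0 (rshift 2 i) : 'rV[R]_(2 + 2)) k = 0.
  by rewrite /xc mxE /= eq_lrshift.
have ey i k : yc (delta_mx 0 (rshift 2 i) : 'rV[R]_(2 + 2)) k = (k == i)%:R.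
  by rewrite /yc mxE /= (inj_eq (@rshift_inj _ _)).
have xD (u v : 'rV[R]_(2 + 2)) i : xc (u + v) i = xc u i + xc v i by rewrite /xc mxE.
have yD (u v : 'rV[R]_(2 + 2)) i : yc (u + v) i = yc u i + yc v i by rewrite /yc mxE.
(* Pairing with the y-directions reads off the x-components of [z *m C], and pairing with the
   x-directions its y-components up to sign. *)
have := (E (delta_mx 0 (rshift 2 0)), E (delta_mx 0 (rshift 2 1)),
  E (delta_mx 0 (lshift 2 0)), E (delta_mx 0 (lshift 2 1))).
rewrite !qC !big_ord_recl !big_ord0 !xD !yD !dx !dy !ex !ey /=.
have -> : lift ord0 ord0 = 1 :> 'I_2 by exact: val_inj.
have -> : ord0 = 0 :> 'I_2 by [].
move=> [[[e1 e2] e3] e4]; split.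
- by apply: etrans (etrans _ e1) _; ring.
- by apply: etrans (etrans _ e2) _; ring.
- by apply: oppr_inj; apply: etrans (etrans _ e3) _; ring.
- by apply: oppr_inj; apply: etrans (etrans _ e4) _; ring.
Qed.

End focus_focus_linearization.

(** * The linearized flow at a fixed point *)

Section fixed_points.
Variables (R : realType) (n : nat) (M : manifold R n) (w : symplectic_form M).

(** The constant curve at [p] is an integral curve, and integral curves are unique. *)
Lemma flow_fixes (F : M -> R) th p : ham_flow w F th ->
  (forall c, atlas c -> cdom c p -> ham_vf w c F (cmap c p) = 0) ->
  forall t, th t p = p.
Proof.
move=> thF X0 t.
rewrite -(@integral_curve_unique R n M w F th thF (fun _ => p) t) //.
split; first exact: cst_continuous.
by move=> s c ac cp; rewrite X0 //; exact: is_derive_cst.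
Qed.

Variables (F : M -> R) (th : R -> M -> M) (c : chart R M n) (p : M).
Hypotheses (thF : ham_flow w F th) (ac : atlas c) (cp : cdom c p).
Hypothesis thp : forall t, th t p = p.

Let D t v := 'd (loc (th t) c c) (cmap c p) v.

Lemma flow_diff0 v : D 0 v = v.
Proof.
have [th0 _ _ _] := thF; have idE : th 0 = id by apply/funext => q; exact: th0.
by rewrite /D idE; exact: diff_loc_id.
Qed.

Lemma flow_diffD s t v : D (s + t) v = D s (D t v).
Proof.
have [_ thD _ _] := thF.
have E : th (s + t) = th s \o th t by apply/funext => q; exact: thD.
have cpt : cdom c (th t p) by rewrite thp.
have cps : cdom c (th s (th t p)) by rewrite !thp.
have := diff_loc_comp (flow_smooth thF t) (flow_smooth thF s) ac ac ac cp cpt cps v.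
by rewrite /D E thp.
Qed.

(** As [p] is fixed, the differentials form a one-parameter group of linear maps, so the variational
    equation at time 0 holds at every time with the same matrix. *)
Lemma is_derive_flow_diff_at (t : R) v :
  is_derive t 1 (D^~ v) (D t v *m jacobian (ham_vf w c F) (cmap c p)).
Proof.
have h := is_derive_translate t (is_derive_flow_diff thF ac cp (D t v)).
have E := deriveEjacobian (D t v) (ham_vf_differentiable thF ac cp).
rewrite -E; apply: near_eq_is_derive h; near=> s.
by rewrite -/(D (s - t) (D t v)) -flow_diffD subrK.
Unshelve. all: by end_near. Qed.

Lemma is_derive_flow_coord m (P : 'M[R]_(n, m)) (t : R) v i :
  is_derive t 1 (fun s => (D s v *m P) 0 i)
    ((D t v *m jacobian (ham_vf w c F) (cmap c p) *m P) 0 i).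
Proof.
have -> : (fun s => (D s v *m P) 0 i) = \sum_k (fun s => D s v 0 k * P k i).
  by apply/funext => s; rewrite mxE fct_sumE.
rewrite [X in is_derive _ _ _ X]mxE; apply: is_derive_sum => k.
have [d1 d2] := is_deriveM (is_derive_entry 0 k (is_derive_flow_diff_at t v))
  (is_derive_cst (P k i) t (1 : R)).
split; first exact: d1.
by rewrite [LHS]d2 scaler0 add0r /GRing.scale /= mulrC.
Qed.

Lemma flow_id_of_diff N t : connected [set: M] -> (0 < N)%N ->
  (forall q, th (t *+ N) q = q) -> (forall v, D t v = v) ->
  forall q, th t q = q.
Proof.
move=> Mc N0 tN D1; have [th0 thD _ _] := thF.
apply: (finite_order_id (flow_smooth thF t) N0 _ Mc ac cp (thp t) D1) => q.
rewrite -[RHS](tN q); elim: (N) => [|k IH]; first by rewrite mulr0n th0.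
by rewrite iterS IH -thD mulrS.
Qed.

End fixed_points.

(** * Weights of a circle action at a focus-focus point *)

Section focus_focus_circle_action.
Variables (R : realType) (M : manifold R 4) (w : symplectic_form M).
Variables (F : M -> R) (th : R -> M -> M) (c : chart R M 4) (p : M).
Hypotheses (thF : ham_flow w F th) (ac : atlas c) (cp : cdom c p).
Hypothesis thp : forall t, th t p = p.
Variables (B : 'M[R]_(2 + 2, 4)) (P : 'M[R]_(4, 2 + 2)) (C : 'M[R]_(2 + 2)).
Hypotheses (BP : B *m P = 1%:M) (PB : P *m B = 1%:M) (spC : sp C).
Hypothesis BC : B *m jacobian (ham_vf w c F) (cmap c p) = C *m B.
Variables a b : R.
Hypothesis qC : forall z, sp_quad C z =
  a * (xc z 0 * yc z 1 - xc z 1 * yc z 0) +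
  b * (xc z 0 * yc z 0 + xc z 1 * yc z 1).

Let D t v := 'd (loc (th t) c c) (cmap c p) v.

Let AP : jacobian (ham_vf w c F) (cmap c p) *m P = P *m C.
Proof.
rewrite -[jacobian _ _]mul1mx -PB -(mulmxA P) BC.
by rewrite -!mulmxA BP mulmx1.
Qed.

(** [P] reads coordinates in the frame [B], where the linearized flow solves z' = zC. This splits
    into two planar spirals with the same rotation rate [a] and opposite growth rates [b] and -b. *)
Lemma focus_focus_flow t v (z := v *m P) (z' := D t v *m P) :
  [/\ xc z' 0 = expR (b * t) * (cos (a * t) * xc z 0 - sin (a * t) * xc z 1),
      xc z' 1 = expR (b * t) * (sin (a * t) * xc z 0 + cos (a * t) * xc z 1),
      yc z' 0 = expR (- b * t) * (cos (a * t) * yc z 0 - sin (a * t) * yc z 1) &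
      yc z' 1 = expR (- b * t) * (sin (a * t) * yc z 0 + cos (a * t) * yc z 1)].
Proof.
have dz (s : R) i : is_derive s 1 (fun s => (D s v *m P) 0 i)
    ((D s v *m P *m C) 0 i).
  have E : D s v *m jacobian (ham_vf w c F) (cmap c p) *m P = D s v *m P *m C.
    by rewrite -(mulmxA _ _ P) AP mulmxA.
  rewrite -E; exact: (is_derive_flow_coord thF ac cp thp P s v i).
have V s := focus_focus_vector_field spC qC (D s v *m P).
have z0 : D 0 v *m P = z by congr (_ *m P); exact: (flow_diff0 thF cp).
have [X0 X1] : xc z' 0 = expR (b * t) * (cos (a * t) * xc z 0 - sin (a * t) * xc z 1)
   /\ xc z' 1 = expR (b * t) * (sin (a * t) * xc z 0 + cos (a * t) * xc z 1).
  rewrite -z0.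
  apply: (@spiral_ode R a b (fun s => xc (D s v *m P) 0) (fun s => xc (D s v *m P) 1)).
    by move=> s; have [<- _ _ _] := V s; exact: dz.
  by move=> s; have [_ <- _ _] := V s; exact: dz.
have [Y0 Y1] : yc z' 0 = expR (- b * t) * (cos (a * t) * yc z 0 - sin (a * t) * yc z 1)
   /\ yc z' 1 = expR (- b * t) * (sin (a * t) * yc z 0 + cos (a * t) * yc z 1).
  rewrite -z0.
  apply: (@spiral_ode R a (- b) (fun s => yc (D s v *m P) 0) (fun s => yc (D s v *m P) 1)).
    by move=> s; have [_ _ <- _] := V s; exact: dz.
  by move=> s; have [_ _ _ <-] := V s; exact: dz.
by [].
Qed.

Lemma rotation_flow_id t v : b = 0 -> cos (a * t) = 1 -> sin (a * t) = 0 ->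
  D t v = v.
Proof.
move=> b0 c1 s0; have [X0 X1 Y0 Y1] := focus_focus_flow t v.
rewrite b0 c1 s0 (mul0r t) expR0 !mul1r mul0r ?subr0 ?add0r in X0 X1.
rewrite b0 c1 s0 oppr0 (mul0r t) expR0 !mul1r mul0r ?subr0 ?add0r in Y0 Y1.
suff E : D t v *m P = v *m P by rewrite -[LHS]mulmx1 -PB mulmxA E -mulmxA PB mulmx1.
rewrite mul0r add0r in X1; rewrite mul0r add0r in Y1.
by apply: eq_coords; apply: ord2_ind.
Qed.

Hypothesis thE : effective_circle_moment w F th.
Hypothesis Mc : connected [set: M].

Lemma circle_action_weights : b = 0 /\ (a = 1 \/ a = -1).
Proof.
have [[th0 thD thP] _ _ eff] := thE.
have D2 v : D (2 * pi) v = v.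
  have E : th (2 * pi) = id by apply/funext => q; exact: thP.
  by rewrite /D E; exact: diff_loc_id.
(* The first frame vector; its return after time 2 pi constrains both [a] and [b]. *)
pose v := (delta_mx 0 (lshift 2 0) : 'rV[R]_(2 + 2)) *m B.
have vP : v *m P = delta_mx 0 (lshift 2 0) by rewrite -mulmxA BP mulmx1.
have [X0 X1 _ _] := focus_focus_flow (2 * pi) v.
have x0 : xc (v *m P) 0 = 1 by rewrite vP /xc mxE !eqxx.
have x1 : xc (v *m P) 1 = 0 by rewrite vP /xc mxE.
rewrite D2 x0 x1 !mulr0 subr0 addr0 !mulr1 in X0 X1.
have e0 := expR_gt0 (b * (2 * pi)).
have s0 : sin (a * (2 * pi)) = 0.
  move/esym/eqP: X1; rewrite mulf_eq0 gt_eqF //= => /eqP //.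
have := cos2Dsin2 (a * (2 * pi)); rewrite s0 expr0n /= addr0 => c2.
have b0 : b = 0.
  (* The sign of the cosine is still unknown at this stage, hence the squares. *)
  have e1 : expR (b * (2 * pi)) ^+ 2 = 1.
    by have := congr1 (fun x => x ^+ 2) X0; rewrite exprMn c2 mulr1 expr1n.
  have : expR (b * (2 * pi)) = expR 0.
    by rewrite expR0; apply/eqP; rewrite -(@eqrXn2 _ 2) ?expr1n ?e1 // ltW.
  move/expR_inj/eqP; rewrite mulf_eq0 => /orP[/eqP//|].
  by rewrite mulf_eq0 pnatr_eq0 /= gt_eqF // pi_gt0.
split=> //; move: X0; rewrite b0 mul0r expR0 mul1r => /esym c1.
have [N aN] := cos_eq1_nat c1.
have pi0 : (pi : R) != 0 by rewrite gt_eqF // pi_gt0.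
case: N aN => [|N] aN.
  have a0 : a = 0 by apply/eqP; rewrite -normr_eq0 aN.
  (* With a = b = 0 every time has identity differential; pi has order 2 and is not a multiple of 2
     pi, by parity. *)
  have : forall q, th pi q = q.
    have h1 q : th (pi *+ 2) q = q by rewrite -[pi *+ 2]mulr_natl; exact: thP.
    have h2 v' : D pi v' = v'.
      by apply: rotation_flow_id; rewrite // a0 mul0r ?cos0 ?sin0.
    exact: (flow_id_of_diff thF ac cp thp Mc (isT : (0 < 2)%N) h1 h2).
  move=> /eff[k E].
  have /eqP : (k * 2 - 1)%:~R * (pi : R) = 0.
    by rewrite intrD intrM mulrBl mul1r -mulrA -E subrr.
  rewrite mulf_eq0 (negPf pi0) orbF intr_eq0 => /eqP; lia.
have aS : a * (2 * pi / N.+1%:R) = 2 * pi \/ a * (2 * pi / N.+1%:R) = - (2 * pi).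
  have n0 : N.+1%:R != 0 :> R by rewrite pnatr_eq0.
  case: (ger0P a) aN => [_ ->|_ /eqP]; first by left; rewrite mulrC divfK.
  rewrite eqr_oppLR => /eqP ->; right.
  by rewrite mulNr mulrC divfK.
have : forall q, th (2 * pi / N.+1%:R) q = q.
  have h1 q : th (2 * pi / N.+1%:R *+ N.+1) q = q.
    by rewrite -[_ *+ N.+1]mulr_natr divfK ?pnatr_eq0 //; exact: thP.
  have h2 v' : D (2 * pi / N.+1%:R) v' = v'.
    have tp : 2 * pi = pi *+ 2 :> R by rewrite mulr_natl.
    apply: (rotation_flow_id _ b0).
      by case: aS => ->; rewrite ?cosN tp cos2pi.
    by case: aS => ->; rewrite ?sinN tp sin2pi ?oppr0.
  exact: (flow_id_of_diff thF ac cp thp Mc (isT : (0 < N.+1)%N) h1 h2).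
move=> /eff[k E].
(* 2 pi / (N + 1) is a multiple of 2 pi, so N + 1 divides 1. *)
have k1 : (k * N.+1%:Z)%:~R = 1 :> R.
  have p2 : 2 * pi != 0 :> R by rewrite mulf_neq0 ?pnatr_eq0.
  apply: (mulIf p2); rewrite mul1r intrM mulrAC -E -[N.+1%:~R]/(N.+1%:R).
  by rewrite divfK // pnatr_eq0.
have N00 : N = 0%N.
  have /eqP : (k * N.+1%:Z - 1)%:~R = 0 :> R by rewrite intrB k1 subrr.
  rewrite intr_eq0 subr_eq0 => /eqP /(congr1 absz).
  by rewrite abszM /= => /eqP; rewrite muln_eq1 => /andP[_ /eqP[]].
rewrite N00 in aN; case: (ger0P a) aN => [_ ->|_ /eqP]; first by left.
by rewrite eqr_oppLR => /eqP ->; right.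
Qed.

End focus_focus_circle_action.

(** * Regularity of Hamiltonian vector fields *)

Section smooth_vector_fields.
Variable R : realType.

Lemma Ck_entry (V : normedModType R) m n k (U : set V) (A : V -> 'M[R]_(m, n)) i j :
  open U -> Ck k U A -> Ck k U (fun x => A x i j).
Proof.
move=> Uo hA; apply: (@Ck_linear_comp _ _ _ _ _ _ A (fun M => M i j)) => //.
  by move=> a M N; rewrite !mxE.
exact: coord_continuous.
Qed.

Lemma Ck_mx (V : normedModType R) m n k (U : set V) (A : V -> 'M[R]_(m, n)) :
  open U -> (forall i j, Ck k U (fun x => A x i j)) -> Ck k U A.
Proof.
move=> Uo hA.
have h i : Ck k U (fun x => \sum_j A x i j *: (delta_mx i j : 'M[R]_(m, n))).
  by apply: Ck_sum => // j; apply: CkZ => //; exact: Ck_cst.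
by apply: eq_Ck (Ck_sum (index_enum _) Uo h) => // x _; rewrite -matrix_sum_delta.
Qed.

Lemma Ck_mulmx (V : normedModType R) m n p k (U : set V)
    (A : V -> 'M[R]_(m, n)) (B : V -> 'M[R]_(n, p)) :
  open U -> Ck k U A -> Ck k U B -> Ck k U (fun x => A x *m B x).
Proof.
move=> Uo hA hB; apply: Ck_mx => // i j.
have h l : Ck k U (fun x => A x i l * B x l j).
  by apply: CkM => //; exact: Ck_entry.
by apply: eq_Ck (Ck_sum (index_enum _) Uo h) => // x _; rewrite mxE.
Qed.

Lemma Ck_prod (V : normedModType R) (I : Type) (r : seq I) k (U : set V)
    (f : I -> V -> R) : open U -> (forall i, Ck k U (f i)) ->
  Ck k U (fun x => \prod_(i <- r) f i x).
Proof.
move=> Uo fC; elim: r => [|i r IH].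
  by apply: eq_Ck (@Ck_cst R V R k U 1) => // x; rewrite big_nil.
by apply: eq_Ck (CkM Uo (fC i) IH) => // x _; rewrite big_cons.
Qed.

Lemma Ck_det (V : normedModType R) n k (U : set V) (A : V -> 'M[R]_n) :
  open U -> Ck k U A -> Ck k U (fun x => \det (A x)).
Proof.
move=> Uo hA.
apply: (@Ck_sum _ _ _ _ _ _ (index_enum _)
  (fun (s : 'S_n) x => (-1) ^+ s * \prod_i A x i (s i))) => // s.
apply: CkM => //; first exact: Ck_cst.
by apply: Ck_prod => // i; exact: Ck_entry.
Qed.

Lemma Ck_adj (V : normedModType R) n k (U : set V) (A : V -> 'M[R]_n) :
  open U -> Ck k U A -> Ck k U (fun x => \adj (A x)).
Proof.
move=> Uo hA; apply: Ck_mx => // i j.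
suff : Ck k U (fun x => (-1) ^+ (j + i) * \det (row' j (col' i (A x)))).
  by apply: eq_Ck => // x _; rewrite mxE.
apply: CkM => //; first exact: Ck_cst.
apply: Ck_det => //; apply: Ck_mx => // i' j'.
by apply: eq_Ck (Ck_entry (lift j i') (lift i j') Uo hA) => // x _; rewrite !mxE.
Qed.

Variables (n : nat) (M : manifold R n) (w : symplectic_form M).

(** Cramer's rule: X_F is dF times the adjugate of the Gram matrix, divided by its determinant.
    Unlike [ham_vf_differentiable] this assumes no flow, so it also covers [H]. *)
Lemma smooth_ham_vf_differentiable (F : M -> R) c p : smooth_fun F -> atlas c ->
  cdom c p -> differentiable (ham_vf w c F) (cmap c p).
Proof.
move=> Fs ac cp; have co : open (cimg c) by exact: cimg_open.
have cx := cmap_cimg cp.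
have hD : Ck 1 (cimg c) (dchart c F).
  apply: Ck_mx => // i j.
  have h : Ck 1 (cimg c) ('D_(delta_mx 0 j) (F \o cinv c)).
    by have [_ h] := Fs c ac 2%N; exact: h.
  by apply: eq_Ck h => // x _; rewrite mxE.
have hW := sform_smooth w ac 1.
have h1 := Ck_mulmx co hD (Ck_adj co hW).
have [+ _] := h1 => /(_ _ cx) d1.
have [+ _] := Ck_det co hW => /(_ _ cx) d2.
have u : \det (sform w c (cmap c p)) != 0.
  by rewrite -unitfE -unitmxE; exact: sform_nondeg.
have d3 := differentiableV d2 u.
have [d _] := is_diff_scale (differentiableP d3) (differentiableP d1).
apply: near_differentiable d _.
apply: filterS (near_cimg cx) => y cy.
by rewrite /ham_vf /invmx (sform_nondeg w ac cy) scalemxAr.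
Qed.

Lemma ham_vf_pair_comp (J H K : M -> R) (k : R * R -> R) c p :
  smooth_fun J -> smooth_fun H -> atlas c -> cdom c p ->
  (\forall q \near p, K q = k (J q, H q)) ->
  differentiable k (J p, H p) ->
  ham_vf w c K (cmap c p) =
  'D_(1, 0) k (J p, H p) *: ham_vf w c J (cmap c p) +
  'D_(0, 1) k (J p, H p) *: ham_vf w c H (cmap c p).
Proof.
move=> Js Hs ac cp Kk dk; set x := cmap c p.
have dJ := smooth_fun_diff Js ac cp; have dH := smooth_fun_diff Hs ac cp.
have JHx : ((J \o cinv c) x, (H \o cinv c) x) = (J p, H p) by rewrite /= cmapK.
have dk' : differentiable k ((J \o cinv c) x, (H \o cinv c) x) by rewrite JHx.
have hJH := is_diff_pair (differentiableP dJ) (differentiableP dH).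
have hk := is_diff_comp hJH (differentiableP dk').
have kK : \forall y \near x, (k \o (fun y => ((J \o cinv c) y, (H \o cinv c) y))) y =
    (K \o cinv c) y.
  by apply: filterS (near_chart cp Kk) => y yE /=; rewrite yE.
have hK := near_is_diff kK hk.
have dE : dchart c K x = 'D_(1, 0) k (J p, H p) *: dchart c J x +
    'D_(0, 1) k (J p, H p) *: dchart c H x.
  apply/rowP => j; rewrite !mxE.
  apply: etrans (is_diff_derive (delta_mx 0 j) hK) _ => /=.
  rewrite cmapK // -(deriveE _ dJ) -(deriveE _ dH).
  set a := 'D_(delta_mx 0 j) _ x; set b := 'D_(delta_mx 0 j) _ x.
  have -> : (a, b) = a *: (1, 0) + b *: (0, 1) :> R * R.
    apply/pair_equal_spec; rewrite /= /GRing.scale /=.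
    by rewrite !mulr0 !mulr1 addr0 add0r.
  have L (r : R) (u : R * R) : 'd k (J p, H p) (r *: u) = 'D_u k (J p, H p) * r.
    by rewrite linearZ (deriveE _ dk); exact: mulrC.
  by rewrite linearD !L.
by rewrite /ham_vf dE mulmxDl -!scalemxAl.
Qed.

End smooth_vector_fields.

(** * Uniqueness of the circle action *)

Section comparison_of_flows.
Variable R : realType.

(** As the derivative exists, its difference quotients may be tested along r / (N + 1), where they
    all vanish. *)
Lemma derive_zero_on_sequence (V : normedModType R) (f : R -> V) (Y : V) (r : R) :
  0 < r -> is_derive (0 : R) 1 f Y -> f 0 = 0 ->
  (forall N : nat, f (r / N.+1%:R) = 0) -> Y = 0.
Proof.
move=> r0 [fd <-] f0 fN; apply/eqP; apply: contrapT => /negP Y0.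
have e0 : 0 < `|'D_1 f 0| by rewrite normr_gt0.
have fd' : h^-1 *: ((f \o shift 0) (h *: 1) - f 0) @[h --> (0 : R)^'] --> 'D_1 f 0.
  exact: fd.
move: fd' e0; set D := 'D_1 f 0 => fd' e0.
have /cvgrPdist_lt/(_ _ e0) /nbhs_ballP[d /= d0 dP] := fd'.
pose N := Num.truncn (r / d).
have tN : 0 < r / N.+1%:R by rewrite divr_gt0.
have lt : r / N.+1%:R < d.
  have /andP[_ h] := truncn_itv (ltW (divr_gt0 r0 d0)).
  by rewrite ltr_pdivrMr // mulrC -ltr_pdivrMr.
have := dP (r / N.+1%:R) _ _.
rewrite -ball_normE /= sub0r normrN gtr0_norm // => /(_ lt).
rewrite gt_eqF // => /(_ isT).
have -> : r / N.+1%:R *: (1 : R) = r / N.+1%:R by exact: mulr1.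
rewrite addr0 fN f0 subr0 scaler0 subr0.
by rewrite ltxx.
Qed.

Variables (n : nat) (M : manifold R n) (w : symplectic_form M).

Lemma ham_vf_of_flows_agree (F K : M -> R) thF thK (z r : R) q c : 0 < r ->
  ham_flow w F thF -> ham_flow w K thK ->
  (forall N : nat, thK (r / N.+1%:R) q = thF (z * (r / N.+1%:R)) q) ->
  atlas c -> cdom c q ->
  ham_vf w c K (cmap c q) = z *: ham_vf w c F (cmap c q).
Proof.
move=> r0 [F0 _ _ FI] [K0 _ _ KI] FK ac cq.
have [_ /(_ 0 c ac)] := FI q; rewrite F0 => /(_ cq) [/derivable1_diffP dF vF].
have [_ /(_ 0 c ac)] := KI q; rewrite K0 => /(_ cq) dK.
have hz : is_diff (0 : R) (fun s : R => z * s) (fun s => z * s).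
  apply: is_diff_linear => [a x y|x]; first by rewrite mulrDr mulrCA.
  exact: mulrl_continuous.
have dF' : differentiable (cmap c \o thF^~ q) (z * 0) by rewrite mulr0.
have := @is_diff_is_derive R R _ _ _ _ 1 (is_diff_comp hz (differentiableP dF')).
rewrite /= mulr0 mulr1.
have -> : 'd (cmap c \o thF^~ q) 0 z = z *: ham_vf w c F (cmap c q).
  rewrite -vF -[X in 'd _ _ X](_ : z *: (1 : R) = z); last exact: mulr1.
  by rewrite linearZ; congr (_ *: _); apply: esym; exact: deriveE.
move=> dF2; apply/eqP; rewrite -subr_eq0; apply/eqP.
apply: (derive_zero_on_sequence r0 (is_deriveB dK dF2)).
  by rewrite !fctE /= mulr0 K0 F0 subrr.
by move=> N; rewrite !fctE /= FK subrr.
Qed.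

Lemma proportional_ham_vf (F K : M -> R) (z : R) : connected [set: M] ->
  smooth_fun F -> smooth_fun K ->
  (forall q c, atlas c -> cdom c q ->
     ham_vf w c K (cmap c q) = z *: ham_vf w c F (cmap c q)) ->
  exists a, forall q, K q = z * F q + a.
Proof.
move=> Mc Fs Ks FK; pose f q := K q - z * F q.
have df q c v : atlas c -> cdom c q ->
    differentiable (f \o cinv c) (cmap c q) /\ 'D_v (f \o cinv c) (cmap c q) = 0.
  move=> ac cq; have cx := cmap_cimg cq.
  have dF := smooth_fun_diff Fs ac cq; have dK := smooth_fun_diff Ks ac cq.
  have hf := is_diffB (differentiableP dK) (is_diffZ z (differentiableP dF)).
  split; first by have [] := hf.
  apply: etrans (is_diff_derive v hf) _; rewrite !fctE /=.
  rewrite -(deriveE _ dK) -(deriveE _ dF).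
  rewrite -(ham_vfE w v ac cx dK) -(ham_vfE w v ac cx dF) FK //.
  by rewrite /bilin -!scalemxAl mxE subrr.
(* [connected] admits the empty space, which has no base point. *)
have [[q0 _]|/set0P/negP/negPn/eqP M0] := EM ([set: M] !=set0); last first.
  exists 0 => q; suff : set0 q by [].
  by rewrite -M0.
exists (f q0) => q; suff : f q = f q0 by move=> <-; rewrite /f subrKC.
have fc : continuous f.
  apply: chart_differentiable_continuous => x.
  by have [] := df x _ 0 (chart_at_atlas x) (chart_at_dom x).
apply: (@connected_clopen M [set q | f q = f q0]) => //.
- rewrite openE => x /= fx; set c := chart_at x.
  have ac : atlas c := chart_at_atlas x; have cx : cdom c x := chart_at_dom x.
  have /nbhs_ballP[r /= r0 rP] := near_cimg (cmap_cimg cx).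
  have yr : \forall y \near x, ball (cmap c x) r (cmap c y).
    exact: (cmap_cont cx (nbhsx_ballx _ _ r0)).
  apply: filterS2 yr (near_cdom cx) => y yr cy /=; rewrite -fx.
  have D y' : ball (cmap c x) r y' -> differentiable (f \o cinv c) y' /\
      forall v, 'D_v (f \o cinv c) y' = 0.
    move=> /rP cy'; have := cinvK cy'; have cd := cinv_cdom cy'.
    move=> E; rewrite -E; split; first by have [] := df _ c 0 ac cd.
    by move=> v; have [] := df _ c v ac cd.
  have := @zero_derivative_constant _ _ (f \o cinv c) (cmap c x) r.
  move=> /(_ (fun y' h => (D y' h).1) (fun y' v h => (D y' h).2 v) _ yr).
  by rewrite /= !cmapK.
- apply: (@closed_comp _ _ f [set f q0]); first by move=> t _; exact: fc.
  exact: accessible_closed_set1 (hausdorff_accessible (@Rhausdorff R)) _.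
- by exists q0.
Qed.

End comparison_of_flows.

(** * Circle moment maps that factor through (J, H) *)

Section uniqueness.
Variables (R : realType) (S : integrable_system R).
Let M := phase_space S.
Let J : M -> R := @Jmap R S.
Let H : M -> R := @Hmap R S.
Let w := omega S.
Let Js : smooth_fun J := @J_smooth R S.
Let Hs : smooth_fun H := @H_smooth R S.

Lemma rank0_ham_vf p c : rank_at J H p 0 -> atlas c -> cdom c p ->
  ham_vf w c J (cmap c p) = 0 /\ ham_vf w c H (cmap c p) = 0.
Proof.
move=> /(_ c) r0 ac cp; have /eqP := r0 ac cp.
rewrite mxrank_eq0 => /eqP E; split.
  by rewrite /ham_vf -(col_mxKu (dchart c J _) (dchart c H (cmap c p))) E linear0 mul0mx.
by rewrite /ham_vf -(col_mxKd (dchart c J (cmap c p)) (dchart c H _)) E linear0 mul0mx.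
Qed.

Lemma ham_vf_comb (a b : R) c p : atlas c -> cdom c p ->
  ham_vf w c (fun q => a * J q + b * H q) (cmap c p) =
  a *: ham_vf w c J (cmap c p) + b *: ham_vf w c H (cmap c p).
Proof.
move=> ac cp; set x := cmap c p.
have dJ := smooth_fun_diff Js ac cp; have dH := smooth_fun_diff Hs ac cp.
have hf := is_diffD (is_diffZ a (differentiableP dJ))
  (is_diffZ b (differentiableP dH)).
have dE : dchart c (fun q => a * J q + b * H q) x =
    a *: dchart c J x + b *: dchart c H x.
  apply/rowP => j; rewrite ![in LHS]mxE ![in RHS]mxE.
  apply: etrans (is_diff_derive (delta_mx 0 j) hf) _.
  by rewrite (deriveE _ dJ) (deriveE _ dH).
by rewrite /ham_vf dE mulmxDl -!scalemxAl.
Qed.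

Lemma row_comb m n (A B : 'M[R]_(m, n)) (a b : R) i u v :
  row i A = u -> row i B = v -> row i (a *: A + b *: B) = a *: u + b *: v.
Proof. by move=> <- <-; apply/rowP => j; rewrite !mxE. Qed.

(** In the product rule the derivatives of [f] and [g] multiply X(x) = 0 and Y(x) = 0; a combination
    with variable coefficients thus linearizes like one with constant coefficients. *)
Lemma jacobian_comb (X Y Z : 'rV[R]_4 -> 'rV[R]_4) (f g : 'rV[R]_4 -> R) x :
  X x = 0 -> Y x = 0 -> differentiable X x -> differentiable Y x ->
  differentiable f x -> differentiable g x ->
  (\forall y \near x, Z y = f y *: X y + g y *: Y y) ->
  jacobian Z x = f x *: jacobian X x + g x *: jacobian Y x.
Proof.
move=> X0 Y0 dX dY df dg ZE.
have hZ := is_diffD (is_diff_scale (differentiableP df) (differentiableP dX))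
  (is_diff_scale (differentiableP dg) (differentiableP dY)).
have ZE' : \forall y \near x, (fun y => f y *: X y + g y *: Y y) y = Z y.
  by apply: filterS ZE => y ->.
have [_ E] := near_is_diff ZE' hZ.
have rJ (h : 'rV[R]_4 -> 'rV[R]_4) i : row i (jacobian h x) = 'd h x (delta_mx 0 i).
  by rewrite rowE /jacobian mul_rV_lin1.
apply/row_matrixP => i; apply: etrans (rJ Z i) _; apply: esym.
apply: etrans (row_comb (f x) (g x) (rJ X i) (rJ Y i)) _.
apply: esym; apply: etrans (congr1 (fun h => h (delta_mx 0 i)) E) _.
have key (r s : R) (u v : 'rV[R]_4) : r *: X x + u + (s *: Y x + v) = u + v.
  by rewrite X0 Y0 !scaler0 !add0r.
exact: key.
Qed.

(** At rank 0 all of R^2 is isotropy, so every combination of the two linearizations belongs to the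
    linearized algebra; non-degeneracy puts it in sp and the normal form gives its quadratic
    Hamiltonian. *)
Lemma focus_focus_frame p c : focus_focus p -> atlas c -> cdom c p ->
  exists (B : 'M[R]_(2 + 2, 4)) (P : 'M[R]_(4, 2 + 2)),
  [/\ B *m P = 1%:M, P *m B = 1%:M &
  forall a b, let C := B *m (a *: jacobian (ham_vf w c J) (cmap c p) +
                             b *: jacobian (ham_vf w c H) (cmap c p)) *m P in
    sp C /\ exists d e, forall z, sp_quad C z =
      d * (xc z 0 * yc z 1 - xc z 1 * yc z 0) +
      e * (xc z 0 * yc z 0 + xc z 1 * yc z 1)].
Proof.
move=> [_ nd [rk nf]] ac cp; have [B [frB hB]] := nf c ac cp.
have [X0 Y0] := rank0_ham_vf rk ac cp.
have [hsp _ _ _] := nd 0%N rk c ac cp B frB.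
have [_ BWB] := frB.
(* From B W B^T = Omega and Omega^2 = -1, the inverse of [B] is W B^T (-Omega). *)
pose P : 'M[R]_(4, 2 + 2) :=
  sform w c (cmap c p) *m B^T *m (- std_sform R 2).
have BP : B *m P = 1%:M.
  rewrite /P !mulmxA BWB mulmxN /std_sform mulmx_block.
  rewrite !mul0mx !mulmx0 !mul1mx !mulNmx !mul1mx !add0r !addr0 opp_block_mx.
  by rewrite !oppr0 !opprK -scalar_mx_block.
have PB : P *m B = 1%:M by exact: mulmx1C BP.
exists B, P; split=> // a b C.
have Ch : linearized_algebra c p B C.
  exists a, b => X; split.
    by rewrite /X ham_vf_comb // X0 Y0 !scaler0 addr0.
  have -> : jacobian X (cmap c p) = a *: jacobian (ham_vf w c J) (cmap c p) +
                             b *: jacobian (ham_vf w c H) (cmap c p).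
    apply: (jacobian_comb (f := fun=> a) (g := fun=> b)) => //.
    - exact: smooth_ham_vf_differentiable.
    - exact: smooth_ham_vf_differentiable.
    - apply: filterS (near_cimg (cmap_cimg cp)) => y cy.
      by rewrite /X -(cinvK cy) ham_vf_comb //; exact: cinv_cdom.
  by rewrite /C -mulmxA PB mulmx1 subrr sub0mx.
split; first exact: hsp.
have : (@sp_quad R 2 @` linearized_algebra c p B) (sp_quad C) by exists C.
by rewrite hB => -[d [e E]]; exists d, e => z; rewrite E.
Qed.


Section second_circle_action.
Variables (K : M -> R) (thJ thK : R -> M -> M).
Hypotheses (Mc : connected [set: M]) (Ks : smooth_fun K).
Hypotheses (thJE : effective_circle_moment w J thJ)
  (thKE : effective_circle_moment w K thK).
Hypothesis KJH : forall q, exists (U : set (R * R)) (k : R * R -> R),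
  [/\ open U, U (J q, H q), smooth_open U k &
      forall q', U (J q', H q') -> K q' = k (J q', H q')].

Let thJF : ham_flow w J thJ. Proof. exact: effective_ham_flow. Qed.
Let thKF : ham_flow w K thK. Proof. exact: effective_ham_flow. Qed.

(** The coefficients are the partial derivatives of [k] along (J, H). Their differentiability is
    what [jacobian_comb] requires, hence two derivatives of [k] are used. *)
Lemma ham_vf_locally_comb q c : atlas c -> cdom c q ->
  exists f g : 'rV[R]_4 -> R,
  [/\ differentiable f (cmap c q), differentiable g (cmap c q) &
      \forall y \near cmap c q,
        ham_vf w c K y = f y *: ham_vf w c J y + g y *: ham_vf w c H y].
Proof.
move=> ac cq; have [U [k [Uo Uq ks KU]]] := KJH q.
have JHc : continuous (fun q => (J q, H q)).
  apply: continuous_pairing; apply: chart_differentiable_continuous => r.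
    exact: (smooth_fun_diff Js (chart_at_atlas r) (chart_at_dom r)).
  exact: (smooth_fun_diff Hs (chart_at_atlas r) (chart_at_dom r)).
have dJH : differentiable (fun y => ((J \o cinv c) y, (H \o cinv c) y)) (cmap c q).
  by apply: differentiable_pair; exact: smooth_fun_diff.
have dk z u : U z -> differentiable ('D_u k) z.
  by have [_ /(_ u) [+ _]] := ks 2%N; apply.
exists ('D_(1, 0) k \o (fun y => ((J \o cinv c) y, (H \o cinv c) y))).
exists ('D_(0, 1) k \o (fun y => ((J \o cinv c) y, (H \o cinv c) y))).
split.
- by apply: differentiable_comp => //; apply: dk; rewrite /= cmapK.
- by apply: differentiable_comp => //; apply: dk; rewrite /= cmapK.
have nU : \forall y \near q, U (J y, H y) by exact: (JHc q _ (open_near Uo Uq)).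
apply: filterS2 (near_chart cq nU) (near_cimg (cmap_cimg cq)) => y Uy cy /=.
rewrite -[y in ham_vf w c K y](cinvK cy) -[y in ham_vf w c J y](cinvK cy).
rewrite -[y in ham_vf w c H y](cinvK cy).
apply: ham_vf_pair_comp => //; first exact: cinv_cdom.
  have nU' : \forall z \near cinv c y, U (J z, H z).
    exact: (JHc _ _ (open_near Uo Uy)).
  by apply: filterS nU' => z; exact: KU.
by have [+ _] := ks 1%N; apply.
Qed.

Lemma poisson_commute_KJ : poisson_commute w K J.
Proof.
move=> c x ac cx; have W := sform_skew w ac cx.
have [f [g [_ _ h]]] := ham_vf_locally_comb ac (cinv_cdom cx).
rewrite (cinvK cx) in h; rewrite (nbhs_singleton h) bilinDl.
have Z (r : R) u v : bilin (sform w c x) (r *: u) v = r * bilin (sform w c x) u v.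
  by rewrite /bilin -!scalemxAl mxE.
have JJ : bilin (sform w c x) (ham_vf w c J x) (ham_vf w c J x) = 0.
  have /eqP := bilin_skew (ham_vf w c J x) (ham_vf w c J x) W.
  by rewrite -addr_eq0 -mulr2n mulrn_eq0 /= => /eqP.
have HJ : bilin (sform w c x) (ham_vf w c H x) (ham_vf w c J x) = 0.
  by rewrite (bilin_skew _ _ W) (JH_commute ac cx) oppr0.
by rewrite !Z JJ HJ !mulr0 addr0.
Qed.

Lemma circle_moment_unique p : @focus_focus R S p ->
  exists z a, (z = 1 \/ z = -1) /\ forall q, K q = z * J q + a.
Proof.
move=> ff; set c := chart_at p.
have ac : atlas c := chart_at_atlas p; have cp : cdom c p := chart_at_dom p.
have [_ _ [rk _]] := ff.
have J0 c' : atlas c' -> cdom c' p -> ham_vf w c' J (cmap c' p) = 0.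
  by move=> ac' cp'; have [] := rank0_ham_vf rk ac' cp'.
have H0 c' : atlas c' -> cdom c' p -> ham_vf w c' H (cmap c' p) = 0.
  by move=> ac' cp'; have [] := rank0_ham_vf rk ac' cp'.
have K0 c' : atlas c' -> cdom c' p -> ham_vf w c' K (cmap c' p) = 0.
  move=> ac' cp'; have [f [g [_ _ h]]] := ham_vf_locally_comb ac' cp'.
  by rewrite (nbhs_singleton h) J0 // H0 // !scaler0 addr0.
have thJp := flow_fixes thJF J0; have thKp := flow_fixes thKF K0.
have [B [P [BP PB hC]]] := focus_focus_frame ff ac cp.
have jJ : jacobian (ham_vf w c J) (cmap c p) =
    1 *: jacobian (ham_vf w c J) (cmap c p) +
    0 *: jacobian (ham_vf w c H) (cmap c p) by rewrite scale1r scale0r addr0.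
have [f [g [df dg h]]] := ham_vf_locally_comb ac cp.
have jK := jacobian_comb (J0 c ac cp) (H0 c ac cp)
  (smooth_ham_vf_differentiable w Js ac cp)
  (smooth_ham_vf_differentiable w Hs ac cp) df dg h.
have [spJ [aJ [bJ qJ]]] := hC 1 0.
have [spK [aK [bK qK]]] := hC (f (cmap c p)) (g (cmap c p)).
rewrite -jJ in spJ qJ; rewrite -jK in spK qK.
have BC (A : 'M[R]_4) : B *m A = B *m A *m P *m B.
  by rewrite -mulmxA PB mulmx1.
have [bJ0 aJ1] := circle_action_weights thJF ac cp thJp BP PB spJ (BC _) qJ thJE Mc.
have [bK0 aK1] := circle_action_weights thKF ac cp thKp BP PB spK (BC _) qK thKE Mc.
have injP (u u' : 'rV[R]_4) : u *m P = u' *m P -> u = u'.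
  by move=> e; rewrite -[u]mulmx1 -PB mulmxA e -mulmxA PB mulmx1.
(* Both weights are 1 or -1, so this product is also their quotient. *)
pose z := aK * aJ.
have z1 : z = 1 \/ z = -1.
  by rewrite /z; case: aJ1 => ->; case: aK1 => ->; rewrite ?mulr1 ?mulrN1 ?opprK;
    [left|right|right|left].
have aJz : aJ * z = aK.
  by rewrite /z; case: aJ1 => ->; rewrite ?mulr1 ?mul1r // !mulrN1 mulN1r opprK.
have DKJ t v : 'd (loc (thK t) c c) (cmap c p) v =
    'd (loc (thJ (z * t)) c c) (cmap c p) v.
  have [x0 x1 y0 y1] := focus_focus_flow thKF ac cp thKp BP PB spK (BC _) qK t v.
  have [x0' x1' y0' y1'] :=
    focus_focus_flow thJF ac cp thJp BP PB spJ (BC _) qJ (z * t) v.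
  have at' : aJ * (z * t) = aK * t by rewrite mulrA aJz.
  rewrite at' bJ0 (mul0r (z * t)) in x0' x1'.
  rewrite at' bJ0 oppr0 (mul0r (z * t)) in y0' y1'.
  rewrite bK0 (mul0r t) in x0 x1; rewrite bK0 oppr0 (mul0r t) in y0 y1.
  have E : 'd (loc (thK t) c c) (cmap c p) v *m P =
      'd (loc (thJ (z * t)) c c) (cmap c p) v *m P.
    by apply: eq_coords; apply: ord2_ind;
      [exact: etrans x0 (esym x0')|exact: etrans x1 (esym x1')
      |exact: etrans y0 (esym y0')|exact: etrans y1 (esym y1')].
  exact: injP E.
suff agree N q : thK (2 * pi / N.+1%:R) q = thJ (z * (2 * pi / N.+1%:R)) q.
  have p0 : 0 < 2 * pi :> R by rewrite mulr_gt0 // pi_gt0.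
  have prop q c' : atlas c' -> cdom c' q ->
      ham_vf w c' K (cmap c' q) = z *: ham_vf w c' J (cmap c' q).
    by apply: (ham_vf_of_flows_agree p0 thJF thKF) => N; exact: agree.
  have [a aE] := proportional_ham_vf Mc Js Ks prop.
  by exists z, a.
set t := 2 * pi / _.
have tN : t *+ N.+1 = 2 * pi.
  by rewrite -[t *+ _]mulr_natr /t divfK // pnatr_eq0.
have [thJ0 thJD _ _] := thJF; have [thK0 thKD _ _] := thKF.
have [[_ _ thJP] _ _ _] := thJE; have [[_ _ thKP] _ _ _] := thKE.
pose tau q := thK t (thJ (- (z * t)) q).
have commute s s' r : thJ s (thK s' r) = thK s' (thJ s r).
  exact: (flows_commute s s' r Js Ks thJF thKF poisson_commute_KJ).
have tauE k r : iter k tau r = thK (t *+ k) (thJ (- (z * t) *+ k) r).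
  elim: k => [|k IH]; first by rewrite !mulr0n thJ0 thK0.
  by rewrite iterS IH /tau commute -thKD -thJD -!mulrS.
(* The two flows commute, so this iterate is [thK] at time 2 pi after [thJ] at time -2 pi z, and
   both are periodic. *)
have tauN r : iter N.+1 tau r = r.
  rewrite tauE tN thKP mulNrn -mulrnAr tN.
  case: z1 => ->; rewrite ?mul1r ?mulN1r ?opprK ?thJP //.
  by rewrite -[in LHS](thJP r) -thJD addNr thJ0.
have tauS : smooth_map tau.
  exact: smooth_map_comp (flow_smooth thJF _) (flow_smooth thKF _).
have taup : tau p = p by rewrite /tau thJp thKp.
have Dtau v : 'd (loc tau c c) (cmap c p) v = v.
  have cJ : cdom c (thJ (- (z * t)) p) by rewrite thJp.
  have cK : cdom c (thK t (thJ (- (z * t)) p)) by rewrite thJp thKp.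
  apply: etrans (diff_loc_comp (flow_smooth thJF _) (flow_smooth thKF t)
    ac ac ac cp cJ cK v) _.
  rewrite thJp; apply: etrans (DKJ t _) _.
  apply: etrans (esym (flow_diffD thJF ac cp thJp (z * t) (- (z * t)) v)) _.
  by rewrite subrr; exact: (flow_diff0 thJF cp).
(* Evaluating tau = id at [thJ (z * t) q] cancels the backward flow of J. *)
have := finite_order_id tauS (ltn0Sn N) tauN Mc ac cp taup Dtau (thJ (z * t) q).
by rewrite /tau -thJD addNr thJ0.
Qed.

End second_circle_action.
End uniqueness.

Theorem proposition4p14 (R : realType) (S1 S2 : integrable_system R)
  (hS1 : faithful_semitoric S1) (hS2 : faithful_semitoric S2)
  (hff : exists p : phase_space S1, focus_focus p) :
  integrable_isomorphic S1 S2 <-> complexity_one_isomorphic S1 S2.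
Proof.
split=> [[Psi [psi iso]]|[Psi [psi [iso _]]]]; last by exists Psi, psi.
(* The given pair is kept: in the presence of a focus-focus point its first component is
   automatically affine with slope 1 or -1. *)
exists Psi, psi; split=> //.
have [symp [psiS _ _] PhiE] := iso; have [_ [g [gs PsiK gK]] _] := symp.
have [Mc [thJ [_ _ thJE _ _]]] := hS1; have [_ [th2 [_ _ th2E _ _]]] := hS2.
have [p ff] := hff.
have [Psis _ _] := symp.
have Ks : smooth_fun (@Jmap R S2 \o Psi).
  exact: smooth_fun_comp Psis (@J_smooth R S2).
have thKE := effective_circle_transport symp gs PsiK gK (@J_smooth R S2) th2E.
have KE q : (@Jmap R S2 \o Psi) q = (psi (Phi q)).1 by rewrite -PhiE.
have KJH (q : phase_space S1) : exists (U : set (R * R)) (k : R * R -> R),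
    [/\ open U, U (Jmap q, Hmap q), smooth_open U k &
        forall q' : phase_space S1, U (Jmap q', Hmap q') ->
          (@Jmap R S2 \o Psi) q' = k (Jmap q', Hmap q')].
  (* Smoothness of [psi] on the image supplies a local extension [h] on an open set; its first
     component is the required [k]. *)
  have [|U [h [Uo Uq hs hE]]] := psiS (Phi q); first by exists q.
  exists U, (fst \o h); split=> // [k|q' Uq'].
    exact: (Ck_linear_comp Uo (@linear_fst R _ _) (@continuous_fst _ _) (hs k)).
  by rewrite KE -hE //; exists q'.
have [z [a [z1 KJ]]] := circle_moment_unique Mc Ks thJE thKE KJH ff.
exists z, a; split=> // _ [q _ <-].
by rewrite -KE KJ.
Qed.
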